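(* Let $\bar w(x_1)$ be a smooth steady planar traveling wave of $\partial_t w+\sum_{j=1}^d\partial_{x_j}f_j(w)=r(w)$, let $A_j=(df_j/dw)(\bar w(x_1))$ and $E v=-(dr/dw)(\bar w)v+(d^2f_1/dw^2)(\bar w)(v,\partial_{x_1}\bar w)$, and consider for $\xi=(\xi_2,\dots,\xi_d)\in\mathbb R^{d-1}$ and $\lambda=\gamma+i\tau$ the linearized resolvent equation on $x_1\in\mathbb R$ $$\lambda v+A_1\partial_{x_1}v+\sum_{j=2}^d i\xi_jA_jv+Ev=f .$$ Assume that $A_1$ is uniformly invertible (i.e. $A_1(x_1)^{-1}$ exists and is bounded uniformly in $x_1$). Then, for common $\gamma_*<0$ and common $\gamma=\Re\lambda>\gamma_*$, and for all $s\ge 1$, the following two conditions are equivalent, with possibly different constants $C$: (a) (pseudodifferential damping) for all frequencies $(\xi,\tau)$, $$\|v\|_{\hat H^s}\le \frac{C(\|f\|_{\hat H^s}+\|v\|_{L^2})}{\Re\lambda-\gamma_*};$$ (b) (high-frequency stability) for all $|\xi,\tau|$ sufficiently large, $$|(\lambda-L_\xi)^{-1}|_{\hat H^s}\le \frac{C}{\Re\lambda-\gamma_*},\qquad L_\xi:=-A_1\partial_{x_1}-\sum_{j=2}^d i\xi_jA_j-E .$$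
   Context: The flux and source functions $f_j,r:\mathbb R^n\to\mathbb R^n$ are smooth, and the profile $\bar w$ and the coefficients $A_j,E$ are smooth and bounded with bounded derivatives. For a function $h$ of $x_1\in\mathbb R$ and a frequency $\xi$, $\|h\|_{\hat H^s}:=\|h\|_{H^s}+(1+|\xi|)^s\|h\|_{L^2}$, with $H^s,L^2$ taken in $x_1$. Constants $C$ are uniform in the frequencies $(\xi,\tau)$ considered. Condition (b) is understood as the solution estimate $\|v\|_{\hat H^s}\le \frac{C}{\Re\lambda-\gamma_*}\|f\|_{\hat H^s}$ for solutions $v$ of the resolvent equation $(\lambda-L_\xi)v=f$, and (a) is likewise an estimate on solutions $v$ of the resolvent equation with data $f$. *)

(* Defs.v *)
From HB Require Import structures.
From mathcomp Require Export all_boot all_order all_algebra.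
From mathcomp Require Export all_classical all_reals all_analysis.
From mathcomp Require Export complex.
Set Implicit Arguments.
Unset Strict Implicit.
Unset Printing Implicit Defensive.
Export Order.TTheory GRing.Theory Num.Theory.
Export numFieldNormedType.Exports.

Local Open Scope classical_set_scope.
Local Open Scope ring_scope.

(* Conventions.  The state space is R^(n.+1) (columns), the physical space is
   R^(d.+1); index ord0 is the direction x_1 and lift ord0 j, for j : 'I_d, are
   the transverse directions x_2, x_3, up to the last one.  Functions of x_1 in
   L^2 or H^s take values in C^(n.+1). *)

Section Smoothness.
Variable R : realType.

Definition partial m (l : 'I_m.+1) (g : 'cV[R]_m.+1 -> 'cV[R]_m.+1)
    (w : 'cV[R]_m.+1) : 'cV[R]_m.+1 :=
  'D_(delta_mx l ord0) g w.

(* C^infty: all iterated partial derivatives exist and are differentiable. *)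
Definition smooth_map m (g : 'cV[R]_m.+1 -> 'cV[R]_m.+1) : Prop :=
  forall (s : seq 'I_m.+1) (w : 'cV[R]_m.+1),
    differentiable (foldr (@partial m) g s) w.

Definition smooth_bounded (V : normedModType R) (F : R -> V) : Prop :=
  (forall (k : nat) (x : R), derivable (derive1n k F) x 1) /\
  (forall k : nat, exists M : R, forall x : R, `|derive1n k F x| <= M).

End Smoothness.

Section BalanceLaw.
Variables (R : realType) (d n : nat).
Variables (f : 'I_d.+1 -> 'cV[R]_n.+1 -> 'cV[R]_n.+1).
Variables (r : 'cV[R]_n.+1 -> 'cV[R]_n.+1).

Definition balance_law_solution (w : R -> 'rV[R]_d.+1 -> 'cV[R]_n.+1) : Prop :=
  forall (t : R) (x : 'rV[R]_d.+1),
    derive1 (w^~ x) t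
    + \sum_(j < d.+1) 'D_(delta_mx ord0 j) (fun y => f j (w t y)) x
    = r (w t x).

Definition steady_planar_wave (wbar : R -> 'cV[R]_n.+1) : Prop :=
  balance_law_solution (fun (_ : R) (x : 'rV[R]_d.+1) => wbar (x ord0 ord0)).

(* Matrix of the differential dg(w) in the canonical basis. *)
Definition Jac (g : 'cV[R]_n.+1 -> 'cV[R]_n.+1) (w : 'cV[R]_n.+1)
    : 'M[R]_n.+1 :=
  \matrix_(k, l) ('d g w (delta_mx l ord0) : 'cV[R]_n.+1) k ord0.

Definition second_diff (g : 'cV[R]_n.+1 -> 'cV[R]_n.+1)
    (w u v : 'cV[R]_n.+1) : 'cV[R]_n.+1 :=
  'd (fun z => 'd g z v : 'cV[R]_n.+1) w u.

Variable wbar : R -> 'cV[R]_n.+1.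

Definition Acoef (j : 'I_d.+1) (x : R) : 'M[R]_n.+1 := Jac (f j) (wbar x).

(* Matrix of the zeroth-order operator
   v |-> - dr(wbar) v + d^2 f_1(wbar)(v, wbar'). *)
Definition Ecoef (x : R) : 'M[R]_n.+1 :=
  - Jac r (wbar x)
  + \matrix_(k, l)
      (second_diff (f ord0) (wbar x) (delta_mx l ord0) (derive1 wbar x)) k ord0.

End BalanceLaw.

Definition uniformly_invertible (R : realType) n (A : R -> 'M[R]_n.+1) : Prop :=
  exists M : R, forall x : R, A x \in unitmx /\ `|invmx (A x)| <= M.

Section Sobolev.
Variables (R : realType) (n : nat).
Local Notation mu := (@lebesgue_measure R).
Local Notation vfun := (R -> 'cV[R[i]]_n).

Definition cvnorm (z : 'cV[R[i]]_n) : R :=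
  Num.sqrt (\sum_(i < n) (ComplexField.Normc.normc (z i ord0)) ^+ 2).

Definition reC (h : vfun) (i : 'I_n) (x : R) : R := complex.Re (h x i ord0).
Definition imC (h : vfun) (i : 'I_n) (x : R) : R := complex.Im (h x i ord0).

Definition inL2 (h : vfun) : Prop :=
  forall i : 'I_n, reC h i \in Lfun mu 2%:E /\ imC h i \in Lfun mu 2%:E.

Definition L2norm (h : vfun) : \bar R :=
  Lnorm mu 2%:E (fun x => (cvnorm (h x))%:E).

Definition test_function (phi : R -> R) : Prop :=
  [/\ forall x, derivable phi x 1,
      continuous (derive1 phi) &
      exists M : R, forall x, M < `|x| -> phi x = 0].

(* Weak differentiability in L^2, tested against C^1_c as in Brezis' textbook
   (this yields the same weak derivative as C^infty_c). *)
Definition weak_deriv (h g : vfun) : Prop :=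
  [/\ inL2 h, inL2 g &
      forall phi : R -> R, test_function phi -> forall i : 'I_n,
        (\int[mu]_x (reC h i x * derive1 phi x)
           = - (\int[mu]_x (reC g i x * phi x))) /\
        (\int[mu]_x (imC h i x * derive1 phi x)
           = - (\int[mu]_x (imC g i x * phi x)))
  ].

(* A chosen representative of the weak derivative (unique up to a null set);
   meaningful only when one exists, otherwise 0. *)
Definition wD (h : vfun) : vfun := xget (fun _ => 0) [set g | weak_deriv h g].

(* Squared Gagliardo (Slobodeckij) seminorm of order sigma in ]0, 1[. *)
Definition gagliardo_sq (sigma : R) (h : vfun) : \bar R :=
  (\int[mu]_x \int[mu]_y
     (cvnorm (h x - h y) ^+ 2 / (`|x - y| `^ (1 + 2 * sigma)))%:E)%E.

(* H^s(R) for real s >= 0, s = k + sigma with k integer and 0 <= sigma < 1. *)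
Definition Hs_norm (s : R) (h : vfun) : \bar R :=
  let k := Num.truncn s in
  let sigma := s - k%:R in
  ((\sum_(j < k.+1) L2norm (iter j wD h) ^+ 2
    + (if (sigma == 0)%R then 0 else gagliardo_sq sigma (iter k wD h)))
     `^ 2^-1)%E.

Definition inHs (s : R) (h : vfun) : Prop :=
  [/\ inL2 h,
      forall j : nat, (j < Num.truncn s)%N ->
        exists g : vfun, weak_deriv (iter j wD h) g
    & (Hs_norm s h < +oo)%E].

End Sobolev.

Section Frequencies.
Variables (R : realType) (d : nat).

Definition freq_norm (xi : 'rV[R]_d) : R :=
  Num.sqrt (\sum_(j < d) xi ord0 j ^+ 2).

Definition freq_norm2 (xi : 'rV[R]_d) (tau : R) : R :=
  Num.sqrt (\sum_(j < d) xi ord0 j ^+ 2 + tau ^+ 2).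

Definition hatHs_norm n (s : R) (xi : 'rV[R]_d) (h : R -> 'cV[R[i]]_n) :
    \bar R :=
  (Hs_norm s h + ((1 + freq_norm xi) `^ s)%:E * L2norm h)%E.

End Frequencies.

Section Resolvent.
Variables (R : realType) (d n : nat).
Variables (A : 'I_d.+1 -> R -> 'M[R]_n.+1) (E : R -> 'M[R]_n.+1).
Local Notation mu := (@lebesgue_measure R).
Local Notation vfun := (R -> 'cV[R[i]]_n.+1).

Definition cmx (M : 'M[R]_n.+1) : 'M[R[i]]_n.+1 := map_mx (real_complex R) M.

Definition Lop (xi : 'rV[R]_d) (v : vfun) : vfun := fun x =>
  - (cmx (A ord0 x) *m wD v x)
  - \sum_(j < d)
      ('i%C * (xi ord0 j)%:C%C) *: (cmx (A (lift ord0 j) x) *m v x)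
  - cmx (E x) *m v x.

Definition resolvent_eq (xi : 'rV[R]_d) (lambda : R[i]) (v f : vfun) : Prop :=
  {ae mu, forall x, lambda *: v x - Lop xi v x = f x}.

(* In both conditions gamma = Re lambda is fixed; the constant is uniform in the
   frequencies (xi, tau) and in the pair (v, f). *)
Definition pseudodifferential_damping (gammas gamma s : R) : Prop :=
  exists2 C : R, 0 < C &
    forall (xi : 'rV[R]_d) (tau : R) (v f : vfun),
      inHs s v -> inHs s f ->
      resolvent_eq xi (gamma +i* tau)%C v f ->
      (hatHs_norm s xi v
         <= (C / (gamma - gammas))%:E * (hatHs_norm s xi f + L2norm v))%E.

Definition high_frequency_stability (gammas gamma s : R) : Prop :=
  exists2 C : R, 0 < C &
    exists N : R, forall (xi : 'rV[R]_d) (tau : R), N <= freq_norm2 xi tau ->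
    forall (v f : vfun),
      inHs s v -> inHs s f ->
      resolvent_eq xi (gamma +i* tau)%C v f ->
      (hatHs_norm s xi v <= (C / (gamma - gammas))%:E * hatHs_norm s xi f)%E.

End Resolvent.

(* Main.v *)
Require Import Defs.
From mathcomp Require Import measurable_realfun ring lra.

(** The two estimates differ only in the term in the L^2 norm of v, so everything
is about controlling that term.

Damping implies high-frequency stability. Write X and Y for the hat norms of v
and f, and l for the L^2 norm of v. Since s >= 1, (1 + |xi|) l <= X. Solving the
equation for lambda v bounds |tau| l by a multiple of X + Y, because v' and
(1 + |xi|) v are both controlled by X. Hence |(xi, tau)| l <= C (X + Y)
([high_frequency_absorption]), and for |(xi, tau)| large the damping estimate
X <= D (Y + l) absorbs l.

High-frequency stability implies damping. At high frequency the stability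
estimate is stronger than the damping estimate. At bounded frequency the
invertibility of A_1 turns the equation into an ordinary differential equation
v' = A_1^-1 (f - lambda v - B v) with smooth bounded coefficients, whose
solutions gain one derivative at each use ([derivative_bound], [regularity]).
With k the integer part of s, this bounds v, and all its weak derivatives up to
order k + 1, by the derivatives of f up to order k and by v itself, in L^2.

The fractional part of s is covered by this extra derivative: the Gagliardo
seminorm of the k-th derivative is bounded by its L^2 norm and that of the
derivative of order k + 1, so products and the equation are only ever estimated
at integer orders ([gagliardo_sq_le], [sobolev_bound_Hs_sq]). That bound rests on the inequality
||u(. + t) - u|| <= |t| ||u'|| for weak derivatives, and the Tonelli theorem.

Weak derivatives enter through three facts: they are unique almost everywhere
([fundamental_lemma], [wderiv_uniq]), they obey the product rule with a bounded
C^1 coefficient ([wderivM]), and increments of u are integrals of u'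
([wderiv_increment]). All L^2 bounds are carried out on squared norms, where
constants add up and the components of a vector can be treated one by one. *)

Set Implicit Arguments.
Unset Strict Implicit.
Unset Printing Implicit Defensive.

Local Open Scope classical_set_scope.
Local Open Scope ring_scope.

(** * Reflections and translations of the line *)

Section Invariance.
Variable R : realType.
Local Notation mu := (@lebesgue_measure R).

Lemma measurable_subl (c : R) : measurable_fun setT (fun x : R => c - x).
Proof. exact: measurable_funB. Qed.

(** Both measures give the same length to half-open intervals, which generate
the Borel sets. *)
Lemma lebesgue_measure_subl (c : R) (A : set (measurableTypeR R)) :
  measurable A -> mu A = pushforward mu (fun x : R => c - x) A.
Proof.
have mf : @measurable_fun _ _ (measurableTypeR R) (measurableTypeR R) setT
    (fun x : R => c - x) by exact: measurable_subl.
apply: (@lebesgue_measure_unique R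
  (measure_function_pushforward__canonical__measure_function_Measure mu mf)).
move=> X [[a b] _ <-] /=.
rewrite /pushforward (_ : _ @^-1` _ = `[c - b, c - a[%classic).
  rewrite lebesgue_measure_itv/= lebesgue_measure_itv/= !lte_fin.
  rewrite ltrD2l ltrN2; case: ifP => // _.
  by rewrite -!EFinB; congr (_ %:E); ring.
apply/seteqP; split => x /=; rewrite !in_itv/=; lra.
Qed.

Lemma ge0_integral_subl (c : R) (f : R -> \bar R) :
  measurable_fun setT f -> (forall x, 0 <= f x)%E ->
  (\int[mu]_x f (c - x)%R = \int[mu]_x f x)%E.
Proof.
move=> mf f0.
have ms : @measurable_fun _ _ (measurableTypeR R) (measurableTypeR R) setT
    (fun x : R => c - x) by exact: measurable_subl.
rewrite -[LHS](ge0_integral_pushforward ms mu measurableT mf)//.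
apply: eq_measure_integral => /= A mA _; apply/esym; exact: lebesgue_measure_subl.
Qed.

(** A translation is the composite of two reflections. *)
Lemma ge0_integral_shift (a : R) (f : R -> \bar R) :
  measurable_fun setT f -> (forall x, 0 <= f x)%E ->
  (\int[mu]_x f (x + a)%R = \int[mu]_x f x)%E.
Proof.
move=> mf f0; rewrite -(ge0_integral_subl a mf f0).
rewrite -(@ge0_integral_subl 0 (fun x => f (a - x)%R))//.
  by apply: eq_integral => x _; rewrite sub0r opprK addrC.
exact: (measurableT_comp mf (measurable_subl a)).
Qed.

Lemma measurable_shift d (T : measurableType d) (f : R -> T) (a : R) :
  measurable_fun setT f -> measurable_fun setT (fun x : R => f (x + a)).
Proof. by move=> mf; apply: (measurableT_comp mf); exact: measurable_funD. Qed.

Lemma integral_shift (a : R) (f : R -> \bar R) :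
  mu.-integrable setT f ->
  (\int[mu]_x f (x + a)%R = \int[mu]_x f x)%E.
Proof.
move=> /integrableP[mf fi]; rewrite integralE [RHS]integralE.
have mp : measurable_fun setT f^\+%E := measurable_funepos mf.
have mn : measurable_fun setT f^\-%E := measurable_funeneg mf.
rewrite -(ge0_integral_shift a mp)// -(ge0_integral_shift a mn)//.
by congr (_ - _)%E; apply: eq_integral => x _; rewrite ?funeposE ?funenegE.
Qed.

Lemma integral_subl (c : R) (f : R -> \bar R) : measurable_fun setT f ->
  (\int[mu]_x f (c - x)%R = \int[mu]_x f x)%E.
Proof.
move=> mf; rewrite integralE [RHS]integralE.
have mp : measurable_fun setT f^\+%E := measurable_funepos mf.
have mn : measurable_fun setT f^\-%E := measurable_funeneg mf.
rewrite -(ge0_integral_subl c mp)// -(ge0_integral_subl c mn)//.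
by congr (_ - _)%E; apply: eq_integral => x _; rewrite ?funeposE ?funenegE.
Qed.
End Invariance.

(** * Test functions approximating the indicator of an interval *)

Section Bumps.
Variable R : realType.

(** A quadratic remainder makes the differentiability of functions such as the
square of a positive part a purely algebraic check. *)
Lemma is_derive_quadratic (f : R -> R) (x l K : R) :
  (forall h, `|f (x + h) - f x - l * h| <= K * h ^+ 2) -> is_derive x 1 f l.
Proof.
move=> fK.
have K0 : 0 <= K by have := le_trans (normr_ge0 _) (fK 1); rewrite expr1n mulr1.
have H : h^-1 *: (f (h *: (1:R) + x) - f x) @[h --> 0^'] --> l.
  apply/cvgrPdist_le => e e0.
  near=> h.
  have h0 : h != 0 by near: h; exact: nbhs_dnbhs_neq.
  have -> : l - h^-1 *: (f (h *: (1:R) + x) - f x) =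
      - h^-1 * (f (x + h) - f x - l * h).
    by rewrite /GRing.scale/= mulr1 (addrC h); field.
  rewrite normrM normrN normfV ler_pdivrMl ?normr_gt0//.
  apply: (le_trans (fK h)); rewrite -real_normK ?num_real// expr2 mulrA.
  rewrite [leRHS]mulrC ler_wpM2r//.
  have : `|h| <= e / (K + 1).
    near: h; apply: dnbhs0_le; rewrite divr_gt0//; lra.
  rewrite ler_pdivlMr; last lra.
  by have := normr_ge0 h; nra.
apply: DeriveDef; last exact: cvg_lim H.
by apply/cvg_ex; exists l.
Unshelve. all: by end_near. Qed.

Lemma is_derive_max0_sqr (t : R) :
  is_derive t 1 (fun t : R => Num.max 0 t ^+ 2) (2 * Num.max 0 t).
Proof.
apply: (@is_derive_quadratic _ _ _ 1) => h; rewrite mul1r ler_norml.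
by case: (lerP 0 t) => ht; case: (lerP 0 (t + h)) => hth;
  apply/andP; split; nra.
Qed.

Lemma max0_continuous : continuous (fun t : R => Num.max 0 t).
Proof. by move=> t; apply: continuous_max; [exact: cst_continuous|exact: cvg_id]. Qed.

Let q (a b x : R) : R := (x - a) * (b - x).
Let p (a b x : R) : R := Num.max 0 (q a b x) ^+ 2.
Let p' (a b x : R) : R := 2 * Num.max 0 (q a b x) * (a + b - 2 * x).

Let dq (a b x : R) : is_derive x 1 (q a b) (a + b - 2 * x).
Proof.
rewrite /q; apply: is_derive_eq.
rewrite /GRing.scale/=; ring.
Qed.

Let dp (a b x : R) : is_derive x 1 (p a b) (p' a b x).
Proof. exact: (is_derive1_comp (is_derive_max0_sqr _) (dq a b x)). Qed.

Let cq a b : continuous (q a b).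
Proof.
by move=> x; apply: differentiable_continuous; apply/derivable1_diffP; have [] :=
  dq a b x.
Qed.

Let cp a b : continuous (p a b).
Proof.
by move=> x; apply: differentiable_continuous; apply/derivable1_diffP; have [] :=
  dp a b x.
Qed.

Let cp' a b : continuous (p' a b).
Proof.
move=> x; apply: cvgM.
  apply: cvgM; first exact: cvg_cst.
  apply: continuous_comp; [exact: cq|exact: max0_continuous].
apply: cvgB; first exact: cvg_cst.
by apply: cvgM; [exact: cvg_cst|exact: cvg_id].
Qed.

Let p_ge0 a b x : 0 <= p a b x.
Proof. exact: sqr_ge0. Qed.

Let p_gt0 a b x : a < b -> (0 < p a b x) = (a < x < b).
Proof.
move=> ab; rewrite /p lt_def sqr_ge0 andbT sqrf_eq0.
apply/idP/andP => [h|[h1 h2]].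
  have {h} : 0 < q a b x.
    by move: h; case: (lerP (q a b x) 0) => h; rewrite ?eqxx.
  rewrite /q => h; split; nra.
have h : 0 < q a b x by rewrite mulr_gt0 ?subr_gt0.
by rewrite (max_r (ltW h)) gt_eqF.
Qed.

(** Here p is C^1 and positive exactly on ]a, b[, so that p / (p + e)
increases to the indicator of ]a, b[ when e decreases to 0. *)
Definition bump (a b e x : R) : R := p a b x / (p a b x + e).

Let bump' (a b e x : R) : R := e * p' a b x / (p a b x + e) ^+ 2.

Let dbump (a b e x : R) : 0 < e -> is_derive x 1 (bump a b e) (bump' a b e x).
Proof.
move=> e0.
have h := dp a b x.
have pe : p a b x + e != 0 by rewrite gt_eqF// ltr_wpDl.
have d1 : is_derive x 1 (fun y => p a b y + e) (p' a b x).
  have -> : (fun y => p a b y + e) = p a b + cst e by [].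
  by apply: is_derive_eq; rewrite addr0.
have d2 : is_derive x 1 (fun y => (p a b y + e)^-1) (- (p a b x + e) ^- 2 * p' a b x).
  exact: is_deriveV.
have -> : bump a b e = p a b * (fun y => (p a b y + e)^-1) by [].
apply: is_derive_eq; rewrite /GRing.scale/= /bump'; field.
exact: pe.
Qed.

Lemma bump_test a b e : a < b -> 0 < e -> test_function (bump a b e).
Proof.
move=> ab e0; split.
- by move=> x; have [] := dbump a b x e0.
- have -> : derive1 (bump a b e) = bump' a b e.
    by apply/funext => x; rewrite derive1E; have [_ ->] := dbump a b x e0.
  move=> x; apply: cvgM; first by apply: cvgM; [exact: cvg_cst|exact: cp'].
  apply: cvgV; first by rewrite expf_eq0/= gt_eqF// ltr_wpDl.
  have h : {for x, continuous (fun y => p a b y + e)}.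
    by apply: cvgD; [exact: cp|exact: cvg_cst].
  exact: (cvgM h h).
- exists (`|a| + `|b|) => x xab; rewrite /bump.
  suff -> : p a b x = 0 by rewrite mul0r.
  apply/eqP; apply: contraTT xab => p0; rewrite -leNgt.
  have : 0 < p a b x by rewrite lt_def p0 p_ge0.
  rewrite p_gt0// => /andP[ax xb]; rewrite ler_norml.
  by case: (ler0P a) => ?; case: (ler0P b) => ?; apply/andP; split; lra.
Qed.

Lemma bump_ge0 a b e x : 0 < e -> 0 <= bump a b e x.
Proof. by move=> e0; rewrite divr_ge0// addr_ge0// ltW. Qed.

Lemma bump_le a b e x : a < b -> 0 < e -> bump a b e x <= \1_`]a, b[ x.
Proof.
move=> ab e0; rewrite indicE mem_setE in_itv/= -p_gt0//.
case: (ltP 0 (p a b x)) => h; rewrite /bump/=.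
  by rewrite ler_pdivrMr ?mul1r ?lerDl ?addr_gt0// ltW.
have -> : p a b x = 0 by apply/eqP; rewrite eq_le h p_ge0.
by rewrite mul0r.
Qed.

Lemma bump_cvg a b x : a < b ->
  bump a b n.+1%:R^-1 x @[n --> \oo] --> (\1_`]a, b[ x : R).
Proof.
move=> ab; rewrite indicE mem_setE in_itv/= -p_gt0//.
case: (ltP 0 (p a b x)) => h; rewrite /bump/=.
  have : p a b x + harmonic n @[n --> \oo] --> p a b x + 0.
    by apply: cvgD; [exact: cvg_cst|exact: cvg_harmonic].
  rewrite addr0 => H.
  have : p a b x / (p a b x + harmonic n) @[n --> \oo] --> p a b x / p a b x.
    by apply: cvgM; [exact: cvg_cst|apply: cvgV; rewrite ?gt_eqF].
  by rewrite divff ?gt_eqF.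
have -> : p a b x = 0 by apply/eqP; rewrite eq_le h p_ge0.
under eq_fun do rewrite mul0r.
exact: cvg_cst.
Qed.
End Bumps.

(** * Square-integrable functions *)

Section SquareIntegrable.
Variable R : realType.
Local Notation mu := (@lebesgue_measure R).
Local Notation L2 := (Lfun mu 2%:E).

Lemma Lnorm2E (u : R -> R) :
  Lnorm mu 2%:E (EFin \o u) = ((\int[mu]_x ((u x) ^+ 2)%:E) `^ 2^-1)%E.
Proof.
rewrite unlock; congr (_ `^ _)%E; apply: eq_integral => x _ /=.
rewrite powR_mulrn ?normr_ge0// real_normK//. exact: num_real.
Qed.

Lemma Lfun2P (u : R -> R) : u \in L2 <->
  measurable_fun setT u /\ (\int[mu]_x ((u x) ^+ 2)%:E < +oo)%E.
Proof.
split=> [uL|[mu_ iu]].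
  split; first by move: (sub_Lfun_mfun uL); rewrite inE.
  move: (sub_Lfun_finLfun uL); rewrite inE/= /finite_norm Lnorm2E.
  exact: lty_poweRy.
rewrite inE; apply/andP; split; rewrite inE//=.
rewrite /finite_norm Lnorm2E; exact: poweR_lty.
Qed.

Lemma L2_measurable (u : R -> R) : u \in L2 -> measurable_fun setT u.
Proof. by case/Lfun2P. Qed.

Lemma L2_mul_integrable (u v : R -> R) : u \in L2 -> v \in L2 ->
  mu.-integrable setT (fun x => (u x * v x)%:E).
Proof. by move=> uL vL; apply/Lfun1_integrable; exact: Lfun2_mul_Lfun1. Qed.

Lemma L2D (u v : R -> R) : u \in L2 -> v \in L2 -> (fun x => u x + v x) \in L2.
Proof.
move=> uL vL.
have h : (1 <= 2%:E :> \bar R)%E by rewrite lee_fin ler1n.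
by have := @rpredD _ (Lfun mu 2%:E); exact.
Qed.

Lemma L2_bmul (b u : R -> R) (M : R) : measurable_fun setT b ->
  (forall x, `|b x| <= M) -> u \in L2 -> (fun x => b x * u x) \in L2.
Proof.
move=> mb bM /Lfun2P[mu_ iu]; apply/Lfun2P; split; first exact: measurable_funM.
have M0 : 0 <= M by apply: le_trans (bM 0).
have mu2 : measurable_fun setT (fun x => (u x ^+ 2)%:E).
  by apply/measurable_EFinP; exact: measurable_funX.
apply: (@le_lt_trans _ _ (\int[mu]_x ((M ^+ 2)%:E * (u x ^+ 2)%:E))%E).
  apply: ge0_le_integral => //=.
  - by move=> x _; rewrite lee_fin sqr_ge0.
  - by apply/measurable_EFinP; apply: measurable_funX; exact: measurable_funM.
  - exact: measurable_funeM.
  - move=> x _; rewrite -EFinM lee_fin exprMn ler_wpM2r ?sqr_ge0//.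
    by rewrite -(real_normK (num_real (b x))) lerXn2r ?nnegrE.
rewrite ge0_integralZl//; last 2 first.
  - by move=> x _; rewrite lee_fin sqr_ge0.
  - by rewrite lee_fin sqr_ge0.
by rewrite lte_mul_pinfty// lee_fin sqr_ge0.
Qed.

Lemma L2Z (c : R) (u : R -> R) : u \in L2 -> (fun x => c * u x) \in L2.
Proof. by apply: (@L2_bmul (cst c) _ `|c|) => //; exact: measurable_cst. Qed.

Lemma compact_support_L2 (f : R -> R) (M : R) : continuous f ->
  (forall x, M < `|x| -> f x = 0) -> f \in L2.
Proof.
move=> cf fM; apply/Lfun2P; split; first exact: continuous_measurable_fun.
have : mu.-integrable `[- M, M] (EFin \o (fun x => f x ^+ 2)).
  apply: continuous_compact_integrable; first exact: segment_compact.
  apply: continuous_subspaceT => x; have h := cf x; exact: (cvgM h h).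
move/integrable_mkcond => /(_ _)/integrableP[]; first exact: measurable_itv.
move=> _; apply: le_lt_trans; rewrite le_eqVlt; apply/orP; left; apply/eqP.
apply: eq_integral => x _ /=; rewrite patchE; case: ifPn => /=.
  by rewrite ger0_norm ?sqr_ge0.
rewrite notin_setE/= in_itv/= -ler_norml => /negP; rewrite -ltNge => /fM ->.
by rewrite expr0n/= normr0.
Qed.

Lemma test_continuous (phi : R -> R) : test_function phi -> continuous phi.
Proof.
by move=> [d _ _] x; apply: differentiable_continuous; apply/derivable1_diffP.
Qed.

Lemma test_L2 (phi : R -> R) : test_function phi -> phi \in L2.
Proof.
move=> tf; have [_ _ [M hM]] := tf.
exact: (compact_support_L2 (test_continuous tf) hM).
Qed.

Lemma derive1_test_support (phi : R -> R) M : (forall x, M < `|x| -> phi x = 0) ->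
  forall x, M < `|x| -> derive1 phi x = 0.
Proof.
move=> hM x Mx; rewrite derive1E.
have : \forall y \near x, phi y = cst 0 y.
  have : \forall y \near x, M < `|y|.
    exact: (cvgr_gt _ (@norm_continuous R R x)).
  by apply: filterS => y; exact: hM.
by move/near_eq_derive => ->; rewrite ?derive_cst// oner_neq0.
Qed.

Lemma derive1_test_L2 (phi : R -> R) : test_function phi -> derive1 phi \in L2.
Proof.
move=> [_ c [M hM]]; exact: (compact_support_L2 c (derive1_test_support hM)).
Qed.

End SquareIntegrable.

(** * The fundamental lemma of the calculus of variations *)

Section FundamentalLemma.
Variable R : realType.
Local Notation mu := (@lebesgue_measure R).
Local Notation L2 := (Lfun mu 2%:E).

Lemma indic_L2 (A : set R) : measurable A -> (mu A < +oo)%E -> \1_A \in L2.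
Proof.
move=> mA Aoo; apply/Lfun2P; split; first exact: measurable_indic.
have -> : (\int[mu]_x ((\1_A x) ^+ 2)%:E = \int[mu]_x (\1_A x)%:E)%E.
  by apply: eq_integral => x _; rewrite indicE; case: (x \in A);
    rewrite ?expr1n ?expr0n.
by rewrite integral_indic// setIT.
Qed.

Lemma L2_integrable_on (u : R -> R) (A : set R) : measurable A -> (mu A < +oo)%E ->
  u \in L2 -> mu.-integrable A (EFin \o u).
Proof.
move=> mA Aoo uL; apply/integrable_mkcond => //.
have := L2_mul_integrable uL (indic_L2 mA Aoo).
apply: eq_integrable => // x _; rewrite patchE/= indicE.
by case: (x \in A); rewrite ?mulr1 ?mulr0.
Qed.

Lemma L2_locally_integrable (u : R -> R) : u \in L2 -> locally_integrable setT u.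
Proof.
move=> uL; split; [exact: L2_measurable|exact: openT|move=> K _ cK].
have mK : measurable K := compact_measurable cK.
by have /integrableP[] := L2_integrable_on mK (compact_finite_measure cK) uL.
Qed.

Definition orthogonal_to_tests (u : R -> R) := forall phi, test_function phi ->
  \int[mu]_x (u x * phi x) = 0.

(** The bumps over ]a, b[ converge to its indicator, and u is integrable
there, so that dominated convergence applies. *)
Lemma orthogonal_to_tests_itv (u : R -> R) a b : u \in L2 -> orthogonal_to_tests u ->
  \int[mu]_(x in `]a, b[) u x = 0.
Proof.
move=> uL u0; have [ab|ba] := ltP a b; last first.
  by rewrite set_itv_ge ?Rintegral_set0// bnd_simp -leNgt.
have fin : (mu `]a, b[%classic < +oo)%E.
  by rewrite lebesgue_measure_itv/= lte_fin ab -EFinB ltry.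
have IL : \1_`]a, b[%classic \in L2 by exact: indic_L2.
have int1 := L2_mul_integrable uL IL.
pose fn n x := (u x * bump a b n.+1%:R^-1 x)%:E.
have en n : 0 < n.+1%:R^-1 :> R by rewrite invr_gt0.
have int0 n : (\int[mu]_x fn n x = 0)%E.
  have h := L2_mul_integrable uL (test_L2 (bump_test ab (en n))).
  rewrite /fn -[LHS]fineK ?integrable_fin_num//.
  by congr EFin; exact: u0 (bump_test ab (en n)).
have [|||||_ _] := @dominated_convergence _ _ _ mu setT measurableT fn
   (fun x => (u x * \1_`]a, b[%classic x)%:E) (fun x => `|(u x * \1_`]a, b[%classic x)%:E|%E).
- by move=> n; have /integrableP[] :=
  L2_mul_integrable uL (test_L2 (bump_test ab (en n))).
- by have /integrableP[] := int1.
- apply: aeW => x _; apply: cvg_EFin; first exact: nearW.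
  by apply: cvgM; [exact: cvg_cst|exact: bump_cvg].
- exact: integrable_abse.
- apply: aeW => x n _;
  rewrite lee_fin (normrM _ (bump _ _ _ _)) (normrM _ (\1_`]a, b[%classic x)) ler_wpM2l//.
  rewrite (ger0_norm (bump_ge0 _ _ _ (en n))) (le_trans (bump_le _ ab (en n)))//.
  exact: ler_norm.
rewrite (_ : [sequence _]_n = cst 0%E); last by apply/funext.
move=> H; have E := cvg_unique (@ereal_hausdorff R) H (cvg_cst _).
rewrite Rintegral_mkcond /Rintegral; transitivity (fine (0%E : \bar R)) => //;
  rewrite -E.
congr fine; apply: eq_integral => x _; rewrite patchE indicE.
by case: (x \in _); rewrite ?mulr1 ?mulr0.
Qed.

(** At a Lebesgue point x, u x is the derivative of an integral of u over
intervals, and these integrals all vanish. *)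
Lemma fundamental_lemma (u : R -> R) : u \in L2 -> orthogonal_to_tests u ->
  {ae mu, forall x, u x = 0}.
Proof.
move=> uL u0.
have := lebesgue_differentiation (L2_locally_integrable uL).
apply: filterS; first exact: (ae_filter_ringOfSetsType mu).
move=> x lx.
have fin a b : (mu `[a, b]%classic < +oo)%E.
  rewrite lebesgue_measure_itv/= ; case: ifP => // _; by rewrite -EFinB ltry.
have intab a b := L2_integrable_on (measurable_itv `[a, b]) (fin a b) uL.
have lt1 : x < x + 1 by rewrite ltrDl.
have [|_ <-] := FTC1_lebesgue_pt lt1 (intab (x - 1) (x + 1)) _ lx.
  by rewrite lte_fin; lra.
(* The integral of u over [x - 1, y] vanishes for every y, also when the
   interval is empty or reduced to a point. *)
set F := (X in derive1 X x); suff -> : F = cst 0 by rewrite derive1_cst.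
apply/funext => y; rewrite /F/=.
have [xy|yx] := ltP (x - 1) y; last first.
  have [->|yx'] := eqVneq y (x - 1); first by rewrite set_itv1 Rintegral_set1.
  by rewrite set_itv_ge ?Rintegral_set0// bnd_simp -ltNge lt_neqAle yx'.
have intl : mu.-integrable `]x - 1, y] (EFin \o u).
  apply: L2_integrable_on => //.
  by rewrite lebesgue_measure_itv/=; case: ifP => // _; rewrite -EFinB ltry.
have into : mu.-integrable `]x - 1, y[ (EFin \o u).
  apply: L2_integrable_on => //.
  by rewrite lebesgue_measure_itv/=; case: ifP => // _; rewrite -EFinB ltry.
rewrite -Rintegral_itv_obnd_cbnd// -Rintegral_itv_bndo_bndc//.
exact: orthogonal_to_tests_itv.
Qed.
End FundamentalLemma.

(** * Integrals over a sliding window *)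

Section Translates.
Variable R : realType.
Local Notation mu := (@lebesgue_measure R).
Local Notation L2 := (Lfun mu 2%:E).

(** Extended-real valued, so that finiteness and bounds are handled by the
same inequalities. *)
Definition sqnorm (u : R -> R) : \bar R := (\int[mu]_x ((u x) ^+ 2)%:E)%E.

Lemma sqnorm_ge0 u : (0 <= sqnorm u)%E.
Proof. by apply: integral_ge0 => x _; rewrite lee_fin sqr_ge0. Qed.

Lemma measurable_sqr (u : R -> R) : measurable_fun setT u ->
  measurable_fun setT (fun x => (u x ^+ 2)%:E).
Proof. by move=> m; apply/measurable_EFinP; exact: measurable_funX. Qed.

Lemma sqnorm_shift (u : R -> R) (a : R) : measurable_fun setT u ->
  sqnorm (fun x => u (x + a)) = sqnorm u.
Proof.
move=> m; rewrite /sqnorm.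
rewrite -(@ge0_integral_shift _ a (fun x => (u x ^+ 2)%:E))//.
- exact: measurable_sqr.
- by move=> x; rewrite lee_fin sqr_ge0.
Qed.

Lemma L2_shift (u : R -> R) (a : R) : u \in L2 -> (fun x => u (x + a)) \in L2.
Proof.
move=> /Lfun2P[m f]; apply/Lfun2P; split; first exact: measurable_shift.
by have := sqnorm_shift a m; rewrite /sqnorm => ->.
Qed.

Lemma L2_subl (u : R -> R) (a : R) : u \in L2 -> (fun x => u (a - x)) \in L2.
Proof.
move=> /Lfun2P[m f]; apply/Lfun2P; split.
  exact: (measurableT_comp m (measurable_subl a)).
rewrite (@ge0_integral_subl _ a (fun x => (u x ^+ 2)%:E))//.
  exact: measurable_sqr.
by move=> x; rewrite lee_fin sqr_ge0.
Qed.

Lemma sqnormD_le (u v : R -> R) : measurable_fun setT u -> measurable_fun setT v ->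
  (sqnorm (fun x => u x + v x)%R <= 2%:E * (sqnorm u + sqnorm v))%E.
Proof.
move=> mu_ mv; rewrite /sqnorm.
have mu2 := measurable_sqr mu_; have mv2 := measurable_sqr mv.
rewrite -ge0_integralD//; try by move=> x _; rewrite lee_fin sqr_ge0.
rewrite -ge0_integralZl//.
- apply: ge0_le_integral => //.
  + by move=> x _; rewrite lee_fin sqr_ge0.
  + by apply: measurable_sqr; exact: measurable_funD.
  + by apply: measurable_funeM; exact: emeasurable_funD.
  + move=> x _; rewrite -EFinD -EFinM lee_fin.
    have := sqr_ge0 (u x - v x)%R; nra.
- exact: emeasurable_funD.
- by move=> x _; rewrite -EFinD lee_fin addr_ge0 ?sqr_ge0.
Qed.

Lemma sqnormN u : sqnorm (fun x => - u x) = sqnorm u.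
Proof. by apply: eq_integral => x _; rewrite sqrrN. Qed.

(** The case p = q = 2 of the Hoelder inequality, squared. *)
Lemma cauchy_schwarz (u v : R -> R) : u \in L2 -> v \in L2 ->
  (((\int[mu]_x (u x * v x)) ^+ 2)%:E <= sqnorm u * sqnorm v)%E.
Proof.
move=> uL vL.
have iuv := L2_mul_integrable uL vL.
have [mu_ fu] := (Lfun2P u).1 uL; have [mv fv] := (Lfun2P v).1 vL.
have H : (`| (\int[mu]_x (u x * v x))%:E | <=
    (sqnorm u * sqnorm v) `^ 2^-1)%E.
  rewrite poweRM ?sqnorm_ge0// /sqnorm -!Lnorm2E.
  apply: le_trans (hoelder mu mu_ mv _ _ _) => //; last first.
    by rewrite [RHS]splitr !div1r.
  rewrite Lnorm1 /Rintegral fineK ?integrable_fin_num//.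
  by apply: le_abse_integral => //; have /integrableP[] := iuv.
move: H; have : (0 <= sqnorm u * sqnorm v)%E by rewrite mule_ge0 ?sqnorm_ge0.
case: (sqnorm u * sqnorm v)%E => [x|_ _|//]; last exact: leey.
rewrite !lee_fin => x0. rewrite powR12_sqrt// => h.
by rewrite -(real_normK (num_real _)) -(sqr_sqrtr x0) lerXn2r ?nnegrE ?sqrtr_ge0.
Qed.

(** The integral of g over [x, x + h[. The window is written as an indicator
over the whole line so that the theorems on product measures apply. *)
Definition fwd_integral (h : R) (g : R -> R) (x : R) : R :=
  \int[mu]_t (\1_`[0, h[ t * g (x + t)).

Lemma indic_itv_L2 (a b : R) : \1_`[a, b[%classic \in L2.
Proof.
apply: indic_L2 => //.
by rewrite lebesgue_measure_itv/=; case: ifP => // _; rewrite -EFinB ltry.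
Qed.

Lemma sqnorm_indic (h : R) : 0 <= h -> sqnorm \1_`[0, h[%classic = h%:E.
Proof.
move=> h0; rewrite /sqnorm.
have -> : (\int[mu]_x ((\1_`[0%R, h[ x) ^+ 2)%:E = \int[mu]_x (\1_`[0%R, h[ x)%:E)%E.
  by apply: eq_integral => x _; rewrite indicE; case: (x \in _);
    rewrite ?expr1n ?expr0n.
rewrite integral_indic//= setIT [LHS]lebesgue_measure_itv/= lte_fin oppr0 addr0.
by case: ltP => // h1; congr EFin; apply/eqP; rewrite eq_le h0 h1.
Qed.

(** Both integrands of the duality between forward and backward windows have
this form, for two choices of (al, be). *)
Definition shear_prod (h al be : R) (a b : R -> R) (z : R * R) : R :=
  \1_`[0, h[ z.2 * (a (z.1 + al * z.2) * b (z.1 + be * z.2)).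

Lemma measurable_line (a : R -> R) (al : R) : measurable_fun setT a ->
  measurable_fun setT (fun z : R * R => a (z.1 + al * z.2)).
Proof.
move=> ma; apply: (measurableT_comp ma); apply: measurable_funD.
  exact: measurable_fst.
by apply: measurable_funM => //; exact: measurable_snd.
Qed.

Lemma measurable_shear_prod h al be a b : measurable_fun setT a ->
  measurable_fun setT b ->
  measurable_fun setT (shear_prod h al be a b).
Proof.
move=> ma mb; apply: measurable_funM.
  have m : measurable_fun setT (\1_`[0, h[%classic : R -> R).
    exact: measurable_indic.
  exact: (measurableT_comp m measurable_snd).
by apply: measurable_funM; exact: measurable_line.
Qed.

(** The product is at most a^2 + b^2, whose integral in x does not depend on t
by translation invariance; the window in t has finite length. *)
Lemma integrable_shear_prod h al be a b : 0 <= h -> a \in L2 -> b \in L2 ->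
  (mu \x mu)%E.-integrable setT (EFin \o shear_prod h al be a b).
Proof.
move=> h0 /Lfun2P[ma fa] /Lfun2P[mb fb].
have mk := measurable_shear_prod h al be ma mb.
have mka : measurable_fun setT (fun z => `|(shear_prod h al be a b z)%:E|%E).
  by apply: measurableT_comp => //; exact/measurable_EFinP.
apply/integrable21ltyP; first exact/measurable_EFinP.
have A0 := sqnorm_ge0 a; have B0 := sqnorm_ge0 b.
have ABfin : (sqnorm a + sqnorm b < +oo)%E by rewrite lte_add_pinfty.
apply: (@le_lt_trans _ _ (\int[mu]_t ((\1_`[0%R, h[ t)%:E * (sqnorm a + sqnorm b)))%E).
  apply: ge0_le_integral => //.
  - by move=> t _; exact: integral_ge0.
    exact: (measurable_fun_fubini_tonelli_G (m1 := mu) _ mka (fun z => abse_ge0 _)).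
  - apply: emeasurable_funM => //; apply/measurable_EFinP; exact: measurable_indic.
  - move=> t _ /=; rewrite /shear_prod/= indicE; case: (t \in _) => /=; last first.
      by rewrite mul0e; under eq_integral do rewrite mul0r normr0; rewrite integral0.
    rewrite mul1e; under eq_integral do rewrite mul1r.
    rewrite -(sqnorm_shift (al * t) ma) -(sqnorm_shift (be * t) mb).
    have sa := measurable_shift (al * t) ma; have sb := measurable_shift (be * t) mb.
    rewrite /sqnorm -ge0_integralD//; try by move=> x _; rewrite lee_fin sqr_ge0.
    + apply: ge0_le_integral => //.
      * apply/measurable_EFinP; apply: measurableT_comp => //.
        exact: measurable_funM.
      * by apply: emeasurable_funD; exact: measurable_sqr.
      * move=> x _; rewrite -EFinD lee_fin normrM.
        set p := a _; set q := b _.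
        rewrite -(real_normK (num_real p)) -(real_normK (num_real q)).
        have := sqr_ge0 (`|p| - `|q|); have := normr_ge0 p; have := normr_ge0 q; nra.
    + exact: measurable_sqr.
    + exact: measurable_sqr.
rewrite ge0_integralZr//; last 2 first.
- by apply/measurable_EFinP; exact: measurable_indic.
- by rewrite adde_ge0.
rewrite integral_indic//= setIT lte_mul_pinfty//.
by rewrite ge0_fin_numE//= [ltLHS]lebesgue_measure_itv/=; case: ifP => // _;
  rewrite -EFinB ltry.
Qed.

Lemma fwd_integral_sqr_le h g x : 0 <= h -> g \in L2 ->
  (((fwd_integral h g x) ^+ 2)%:E <=
   h%:E * \int[mu]_t ((\1_`[0%R, h[ t)%:E * ((g (x + t)%R) ^+ 2)%:E))%E.
Proof.
move=> h0 gL.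
have gxL : (fun t => g (x + t)) \in L2.
  have := L2_shift x gL; by under eq_fun do rewrite addrC.
have IL := indic_itv_L2 0 h.
have vL : (fun t => \1_`[0, h[%classic t * g (x + t)) \in L2.
  apply: (@L2_bmul _ (\1_`[0, h[%classic) _ 1 (L2_measurable IL) _ gxL).
  by move=> t; rewrite indicE; case: (_ \in _); rewrite ?normr1 ?normr0.
have := cauchy_schwarz IL vL; rewrite sqnorm_indic//.
have -> : \int[mu]_t (\1_`[0, h[ t * (\1_`[0, h[ t * g (x + t))) = fwd_integral h g x.
  apply: eq_Rintegral => t _; rewrite indicE.
  by case: (_ \in _); rewrite ?mul1r ?mul0r.
move/le_trans; apply; rewrite lee_wpmul2l ?lee_fin// le_eqVlt; apply/orP; left;
  apply/eqP.
apply: eq_integral => t _; rewrite -EFinM indicE.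
by case: (_ \in _); rewrite ?mul1r// !mul0r expr0n.
Qed.

Lemma measurable_fwd_integral h g : measurable_fun setT g ->
  measurable_fun setT (fwd_integral h g).
Proof.
move=> mg.
have mI : measurable_fun setT (\1_`[0, h[%classic : R -> R) by exact: measurable_indic.
pose F (z : R * R) := (\1_`[0, h[%classic z.2 * g (z.1 + z.2))%:E.
have mF : measurable_fun setT F.
  apply/measurable_EFinP; apply: measurable_funM.
    exact: (measurableT_comp mI measurable_snd).
  apply: (measurableT_comp mg); apply: measurable_funD;
    [exact: measurable_fst|exact: measurable_snd].
have mp : measurable_fun setT F^\+%E := measurable_funepos mF.
have mn : measurable_fun setT F^\-%E := measurable_funeneg mF.
have -> : fwd_integral h g = fine \o
   (fun x => \int[mu]_t F^\+ (x, t) - \int[mu]_t F^\- (x, t))%E.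
  apply/funext => x /=; rewrite /fwd_integral /Rintegral integralE.
  by congr (fine (_ - _)%E); apply: eq_integral => t _; rewrite ?funeposE ?funenegE.
apply: measurableT_comp; first exact: fine_measurable.
apply: emeasurable_funB.
  exact: (measurable_fun_fubini_tonelli_F (m2 := mu) _ mp (funepos_ge0 F)).
exact: (measurable_fun_fubini_tonelli_F (m2 := mu) _ mn (funeneg_ge0 F)).
Qed.

(** Minkowski inequality for the window: Cauchy-Schwarz in t costs a factor h,
and integrating in x first, by Tonelli and translation invariance, a second
one. *)
Lemma sqnorm_fwd_integral h g : 0 <= h -> g \in L2 ->
  (sqnorm (fwd_integral h g) <= (h ^+ 2)%:E * sqnorm g)%E.
Proof.
move=> h0 gL; have mg := L2_measurable gL.
have mI : measurable_fun setT (\1_`[0, h[%classic : R -> R) by exact: measurable_indic.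
pose F (z : R * R) := ((\1_`[0%R, h[ z.2)%:E * ((g (z.1 + 1 * z.2)%R) ^+ 2)%:E)%E.
have mF : measurable_fun setT F.
  apply: emeasurable_funM; apply/measurable_EFinP.
    exact: (measurableT_comp mI measurable_snd).
  by apply: measurable_funX; exact: measurable_line.
have F0 z : (0 <= F z)%E by rewrite mule_ge0// lee_fin ?sqr_ge0.
apply: (@le_trans _ _ (\int[mu]_x (h%:E * \int[mu]_t F (x, t)))%E).
  apply: ge0_le_integral => //.
  - by move=> x _; rewrite lee_fin sqr_ge0.
  - by apply: measurable_sqr; exact: measurable_fwd_integral.
  - apply: measurable_funeM.
    exact: (measurable_fun_fubini_tonelli_F (m2 := mu) _ mF F0).
  - move=> x _; apply: (le_trans (fwd_integral_sqr_le x h0 gL)).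
    by rewrite /F/=; under [in leRHS]eq_integral do rewrite mul1r.
rewrite ge0_integralZl//; last 2 first.
- exact: (measurable_fun_fubini_tonelli_F (m2 := mu) _ mF F0).
- by move=> x _; exact: integral_ge0.
rewrite (fubini_tonelli (m1 := mu) (m2 := mu) _ mF)// expr2 EFinM -muleA.
rewrite lee_wpmul2l ?lee_fin//.
have -> : (\int[mu]_t \int[mu]_x F (x, t) =
   \int[mu]_t ((\1_`[0%R, h[ t)%:E * sqnorm g))%E.
  apply: eq_integral => t _; rewrite /F/= ge0_integralZl//.
  - by under eq_integral do rewrite mul1r; rewrite -(sqnorm_shift t mg).
  - by apply: measurable_sqr; exact: measurable_shift.
  - by move=> x _; rewrite lee_fin sqr_ge0.
rewrite ge0_integralZr//; last 2 first.
- by apply/measurable_EFinP.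
- exact: sqnorm_ge0.
have := sqnorm_indic h0; rewrite /sqnorm => <-.
rewrite lee_wpmul2r ?sqnorm_ge0// le_eqVlt; apply/orP; left; apply/eqP.
by apply: eq_integral => x _; rewrite indicE; case: (x \in _); rewrite ?expr1n ?expr0n.
Qed.

End Translates.

(** * Weak derivatives and increments *)

Section WeakDerivative.
Variable R : realType.
Local Notation mu := (@lebesgue_measure R).
Local Notation L2 := (Lfun mu 2%:E).

(** One real component of [weak_deriv]. *)
Definition wderiv (u g : R -> R) : Prop :=
  [/\ u \in L2, g \in L2 & forall phi, test_function phi ->
   \int[mu]_x (u x * derive1 phi x) = - \int[mu]_x (g x * phi x)].

Lemma RintegralE_fin (f : R -> R) : mu.-integrable setT (EFin \o f) ->
  (\int[mu]_x (f x)%:E = (\int[mu]_x f x)%:E)%E.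
Proof. by move=> fi; rewrite /Rintegral fineK// integrable_fin_num. Qed.

Lemma Rintegral_shift (a : R) (f : R -> R) : mu.-integrable setT (EFin \o f) ->
  \int[mu]_x f (x + a) = \int[mu]_x f x.
Proof.
move=> fi; rewrite /Rintegral; congr fine.
exact: (integral_shift a fi).
Qed.

Lemma test_integrable (phi : R -> R) : test_function phi ->
  mu.-integrable setT (EFin \o phi).
Proof.
move=> tphi; have [_ _ [M hM]] := tphi.
have : mu.-integrable `[- M, M] (EFin \o phi).
  apply: continuous_compact_integrable; first exact: segment_compact.
  by apply: continuous_subspaceT; exact: test_continuous.
move/integrable_mkcond => /(_ (measurable_itv _)); apply: eq_integrable => // x _.
rewrite patchE; case: ifPn => //=.
rewrite notin_setE/= in_itv/= -ler_norml => /negP; rewrite -ltNge => /hM ->.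
by [].
Qed.

Definition bwd_integral (h : R) (psi : R -> R) (x : R) : R :=
  \int[mu]_(y in `]x - h, x]) psi y.

(** The fundamental theorem of calculus for the primitive of psi that vanishes
at minus infinity. *)
Lemma bwd_integral_derive (h : R) (psi : R -> R) (x : R) : 0 <= h ->
  test_function psi ->
  is_derive x 1 (bwd_integral h psi) (psi x - psi (x - h)).
Proof.
move=> h0 tpsi.
have ipsi := test_integrable tpsi.
pose P (x : R) : R := \int[mu]_(t in `]-oo, x]) psi t.
have iP y : mu.-integrable `]-oo, y] (EFin \o psi).
  by apply: integrableS ipsi.
have dP (y : R) : is_derive y 1 P (psi y).
  have := @continuous_FTC1 R psi -oo%O y (y + 1).
  case; [by rewrite ltrDl|exact: iP|by rewrite ltNyr|exact: (test_continuous tpsi)|move=> d1 d2].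
  by apply: DeriveDef => //; rewrite -derive1E.
have -> : bwd_integral h psi = P - (P \o (fun y => y - h)).
  apply/funext => y; apply/esym/(Rintegral_itvB (iP y)) => //.
  by rewrite bnd_simp; lra.
have dh : is_derive x 1 (fun y : R => y - h) 1.
  have -> : (fun y : R => y - h) = id + cst (- h) by [].
  by apply: is_derive_eq; rewrite subr0.
have dPh := @is_derive1_comp R P (fun y => y - h) x _ _ (dP (x - h)) dh.
have d0 := dP x.
by apply: is_derive_eq; rewrite mulr1.
Qed.

Lemma bwd_integral_test (h : R) (psi : R -> R) : 0 <= h -> test_function psi ->
  test_function (bwd_integral h psi).
Proof.
move=> h0 tpsi; split.
- by move=> x; have [] := bwd_integral_derive x h0 tpsi.
- have -> : derive1 (bwd_integral h psi) = (fun x => psi x - psi (x - h)).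
    by apply/funext => x; rewrite derive1E; have [_ ->] :=
      bwd_integral_derive x h0 tpsi.
  move=> x; apply: cvgB; first exact: test_continuous.
  apply: (@continuous_comp _ _ _ (fun y => y - h) psi).
    by apply: cvgB; [exact: cvg_id|exact: cvg_cst].
  exact: test_continuous.
- have [_ _ [M hM]] := tpsi; exists (M + h) => x Mx.
  rewrite /bwd_integral (@eq_Rintegral _ _ _ mu _ (cst 0)) ?Rintegral_cst ?mul0r// => y.
  rewrite inE/= in_itv/= => /andP[y1 y2]; apply: hM.
  move: Mx; case: (ler0P x) => ?; case: (ler0P y) => ?; lra.
Qed.

(** The reflection sending t to x - t maps [0, h[ to the half-open window ]x -
h, x]. *)
Lemma bwd_integralE (h : R) (psi : R -> R) (x : R) : measurable_fun setT psi ->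
  bwd_integral h psi x = \int[mu]_t (\1_`[0, h[ t * psi (x - t)).
Proof.
move=> mpsi; rewrite /bwd_integral Rintegral_mkcond /Rintegral; congr fine.
rewrite -(@integral_subl _ x); last first.
  apply/measurable_EFinP; apply/measurable_restrict => //.
  exact: measurable_funTS.
apply: eq_integral => t _; rewrite patchE indicE; congr EFin.
have -> : (x - t \in `]x - h, x]%classic) = (t \in `[0, h[%classic).
  by rewrite !mem_setE !in_itv/=; apply/idP/idP => /andP[? ?]; apply/andP; split; lra.
by case: (_ \in _); rewrite ?mul1r ?mul0r.
Qed.

Lemma fwd_integral_L2 (h : R) (g : R -> R) : 0 <= h -> g \in L2 ->
  fwd_integral h g \in L2.
Proof.
move=> h0 gL; have [mg fg] := (Lfun2P g).1 gL.
apply/Lfun2P; split; first exact: measurable_fwd_integral.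
apply: le_lt_trans (sqnorm_fwd_integral h0 gL) _.
by rewrite lte_mul_pinfty// lee_fin sqr_ge0.
Qed.

(** Averaging over forward windows is the transpose of averaging over backward
windows: exchange the integrals, translate by t, exchange them again. *)
Lemma fwd_integral_duality (h : R) (g psi : R -> R) : 0 <= h -> g \in L2 ->
  psi \in L2 ->
  \int[mu]_x (g x * \int[mu]_t (\1_`[0, h[ t * psi (x - t))) =
  \int[mu]_x (fwd_integral h g x * psi x).
Proof.
move=> h0 gL pL; rewrite /Rintegral; congr fine.
have IL := indic_itv_L2 0 h.
transitivity (\int[mu]_x \int[mu]_t (shear_prod h 0 (-1) g psi (x, t))%:E)%E.
  apply: eq_integral => x _.
  have i1 : mu.-integrable setT (EFin \o (fun t => \1_`[0, h[%classic t * psi (x - t))).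
    by apply: L2_mul_integrable => //; exact: L2_subl.
  rewrite EFinM -(RintegralE_fin i1) -integralZl//.
  apply: eq_integral => t _; rewrite -EFinM /shear_prod/=; congr EFin.
  by rewrite mul0r addr0 mulN1r; ring.
rewrite (Fubini (integrable_shear_prod 0 (-1) h0 gL pL)).
transitivity (\int[mu]_t \int[mu]_x (shear_prod h 1 0 g psi (x, t))%:E)%E.
  apply: eq_integral => t _; apply/esym.
  have i1 : mu.-integrable setT (fun x => (shear_prod h 0 (-1) g psi (x, t))%:E).
    rewrite /shear_prod/=; under eq_fun do rewrite mul0r addr0 mulN1r EFinM.
    apply: integrableZl => //; apply: L2_mul_integrable => //.
    exact: (L2_shift (- t) pL).
  rewrite -(integral_shift t i1); apply: eq_integral => x _.
  by rewrite /shear_prod/= !mul0r !addr0 mul1r mulN1r addrK.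
rewrite -(Fubini (integrable_shear_prod 1 0 h0 gL pL)).
apply: eq_integral => x _.
have i1 : mu.-integrable setT (EFin \o (fun t => \1_`[0, h[%classic t * g (x + t))).
  apply: L2_mul_integrable => //.
  by have := L2_shift x gL; under eq_fun do rewrite addrC.
rewrite mulrC EFinM /fwd_integral -(RintegralE_fin i1) -integralZl//.
apply: eq_integral => t _; rewrite -EFinM /shear_prod/=; congr EFin.
by rewrite mul0r addr0 mul1r; ring.
Qed.

(** Testing the weak derivative against the backward primitive of psi gives
the integral of the increment of u against psi on one side, and that of the
forward integral of g against psi on the other; the fundamental lemma
concludes. *)
Lemma wderiv_increment (h : R) (u g : R -> R) : 0 <= h -> wderiv u g ->
  {ae mu, forall x, u (x + h) - u x = fwd_integral h g x}.
Proof.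
move=> h0 [uL gL ug].
have uhL := L2_shift h uL; have sL := fwd_integral_L2 h0 gL.
have NL (v : R -> R) : v \in L2 -> (fun x => - v x) \in L2.
  by move=> vL; have := L2Z (-1) vL; under eq_fun do rewrite mulN1r.
have wL := L2D (L2D uhL (NL _ uL)) (NL _ sL).
have := fundamental_lemma wL _.
have H : orthogonal_to_tests (fun x => u (x + h) + - u x + - fwd_integral h g x).
  move=> psi tpsi; have pL := test_L2 tpsi; have tb := bwd_integral_test h0 tpsi.
  have := ug _ tb.
  have -> : derive1 (bwd_integral h psi) = (fun x => psi x - psi (x - h)).
    by apply/funext => x; rewrite derive1E; have [_ ->] :=
      bwd_integral_derive x h0 tpsi.
  have phL := L2_shift (- h) pL.
  have i1 := L2_mul_integrable uL pL; have i2 := L2_mul_integrable uL phL.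
  have i3 := L2_mul_integrable uhL pL; have i4 := L2_mul_integrable sL pL.
  under eq_Rintegral do rewrite mulrBr.
  rewrite RintegralB// -[X in _ - X = _](Rintegral_shift h i2).
  under [X in _ - X = _]eq_Rintegral do rewrite addrK.
  under [X in _ = - X]eq_Rintegral do rewrite (bwd_integralE _ _ (L2_measurable pL)).
  rewrite fwd_integral_duality// => E.
  under eq_Rintegral do rewrite !mulrDl !mulNr.
  rewrite RintegralB//; last by have := integrableB measurableT i3 i1.
  rewrite RintegralB//; move: E; lra.
move/(_ H); apply: filterS; first exact: (ae_filter_ringOfSetsType mu).
by move=> x /eqP; rewrite subr_eq0 => /eqP.
Qed.

Lemma sqnorm_increment (h : R) (u g : R -> R) : 0 <= h -> wderiv u g ->
  (sqnorm (fun x => u (x + h)%R - u x)%R <= (h ^+ 2)%:E * sqnorm g)%E.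
Proof.
move=> h0 ug; have [uL gL _] := ug.
apply: le_trans (sqnorm_fwd_integral h0 gL).
have mu_ := L2_measurable uL.
rewrite le_eqVlt; apply/orP; left; apply/eqP; apply: ae_eq_integral => //.
- apply: measurable_sqr; apply: measurable_funB => //; exact: measurable_shift.
- by apply: measurable_sqr; apply: measurable_fwd_integral; exact: L2_measurable.
- have := wderiv_increment h0 ug.
  apply: filterS; first exact: (ae_filter_ringOfSetsType mu).
  by move=> x -> _.
Qed.
End WeakDerivative.

(** * The Gagliardo seminorm of a weakly differentiable function *)

Section Gagliardo.
Variable R : realType.
Local Notation mu := (@lebesgue_measure R).
Local Notation L2 := (Lfun mu 2%:E).

Lemma integral_powR (a b p : R) : 0 < a -> a <= b -> p != 0 ->
  (\int[mu]_(x in `[a, b]) (x `^ (p - 1))%:E = ((b `^ p - a `^ p) / p)%:E)%E.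
Proof.
move=> a0; rewrite le_eqVlt => /predU1P[->|ab] p0.
  by rewrite subrr mul0r set_itv1 integral_set1.
pose F (x : R) := x `^ p / p.
have dF (x : R) : 0 < x -> is_derive x 1 F (x `^ (p - 1)).
  move=> x0; have h : is_derive x 1 (fun x : R => x `^ p) _ := is_derive1_powR p x0.
  have -> : F = p^-1 *: (fun x : R => x `^ p).
    by apply/funext => y; rewrite /F mulrC fctE.
  apply: is_derive_eq; rewrite /GRing.scale/=; field.
  exact: p0.
have cF (x : R) : 0 < x -> {for x, continuous F}.
  move=> x0; apply: differentiable_continuous; apply/derivable1_diffP.
  by have [] := dF x x0.
rewrite mulrBl EFinB (@continuous_FTC2 _ _ F)//.
- apply: derivable_within_continuous => x; rewrite in_itv/= => /andP[ax _].
  apply: derivable_powR; rewrite in_itv/= andbT; exact: lt_le_trans ax.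
- split.
  + move=> x; rewrite in_itv/= => /andP[ax _].
    by have [] := dF x (lt_trans a0 ax).
  + exact: cvg_at_right_filter (cF a a0).
  + exact: cvg_at_left_filter (cF b (lt_trans a0 ab)).
- move=> x; rewrite in_itv/= => /andP[ax _].
  by rewrite derive1E; have [_ ->] := dF x (lt_trans a0 ax).
Qed.


(** The Gagliardo weight at distance t, times the bound min(t^2, 4) on the
squared increments of functions with L^2 norms of size 1. *)
Definition incr_kernel (s t : R) : R := `|t| `^ (- (1 + 2 * s)) * Num.min (t ^+ 2) 4.

Lemma incr_kernel_ge0 s t : 0 <= incr_kernel s t.
Proof. by rewrite mulr_ge0 ?powR_ge0// le_min sqr_ge0 ler0n. Qed.

Lemma incr_kernelN s t : incr_kernel s (- t) = incr_kernel s t.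
Proof. by rewrite /incr_kernel normrN sqrrN. Qed.

Lemma measurable_incr_kernel s : measurable_fun setT (incr_kernel s).
Proof.
apply: measurable_funM.
  by apply: (measurableT_comp (measurable_powR _)); exact: normr_measurable.
by apply: measurable_minr => //; exact: measurable_funX.
Qed.

(** The integral of t^(1 - 2 s) over ]0, 1[ plus that of 4 t^(-1 - 2 s) over
]1, +oo[. *)
Definition incr_kernel_mass (s : R) : R := (2 - 2 * s)^-1 + 4 * (2 * s)^-1.

(** Up to 1 the weight is compensated by t^2, which needs s < 1; beyond 1 it
is integrable on its own, which needs s > 0. *)
Lemma integral_incr_kernel_itv (s a b : R) : 0 < s < 1 -> 0 < a -> a <= 1 -> 1 <= b ->
  (\int[mu]_(t in `[a, b]) (incr_kernel s t)%:E <= (incr_kernel_mass s)%:E)%E.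
Proof.
move=> /andP[s0 s1] a0 a1 b1.
have -> : `[a, b]%classic = `[a, 1] `|` `]1, b].
  by rewrite -itv_bndbnd_setU// bnd_simp.
have mg D : measurable_fun D (fun t => (incr_kernel s t)%:E).
  by apply: measurable_funTS; apply/measurable_EFinP; exact: measurable_incr_kernel.
have mp p D : measurable_fun D (fun t : R => (t `^ p)%:E).
  by apply: measurable_funTS; apply/measurable_EFinP; exact: measurable_powR.
rewrite ge0_integral_setU//; last 3 first.
- exact: mg.
- by move=> t _; rewrite lee_fin incr_kernel_ge0.
- rewrite disj_set2E; apply/eqP; rewrite disjoints_subset => t /=;
  rewrite !in_itv/= => /andP[_ t1].
  by rewrite ltNge t1.
rewrite /incr_kernel_mass EFinD leeD//.
- apply: (@le_trans _ _ (\int[mu]_(t in `[a, 1%R]) (t `^ ((2 - 2 * s) - 1))%:E)%E).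
    apply: ge0_le_integral => //.
    + by move=> t _; rewrite lee_fin incr_kernel_ge0.
    + exact: mg.
    + exact: mp.
    + move=> t; rewrite /= in_itv/= => /andP[ta _]; have t0 : 0 < t by lra.
      rewrite lee_fin /incr_kernel gtr0_norm// (_ : 2 - 2 * s - 1 = - (1 + 2 * s) + 2%:R); last ring.
      rewrite powRD; last by rewrite (gt_eqF t0) implybT.
      rewrite (powR_mulrn 2 (ltW t0)) ler_wpM2l ?powR_ge0//.
      by rewrite ge_min lexx.
  rewrite integral_powR//; last by rewrite gt_eqF//; lra.
  rewrite lee_fin powR1 mulrC ler_piMr// ?invr_ge0; first lra.
  by rewrite gerBl powR_ge0.
- apply: (@le_trans _ _ (\int[mu]_(t in `]1%R, b]) (4%:E * (t `^ (- (2 * s) - 1))%:E))%E).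
    apply: ge0_le_integral => //.
    + by move=> t _; rewrite lee_fin incr_kernel_ge0.
    + exact: mg.
    + exact: (measurable_funeM _ (mp _ _)).
    + move=> t; rewrite /= in_itv/= => /andP[ta _]; have t0 : 0 < t by lra.
      rewrite -EFinM lee_fin /incr_kernel gtr0_norm// (_ : - (2 * s) - 1 = - (1 + 2 * s)); last ring.
      rewrite mulrC ler_wpM2r ?powR_ge0//.
      by rewrite ge_min lexx orbT.
  rewrite ge0_integralZl//; last by move=> t _; rewrite lee_fin powR_ge0.
  rewrite EFinM lee_wpmul2l ?lee_fin//.
  rewrite integral_itv_obnd_cbnd// integral_powR//; last by rewrite lt_eqF//; lra.
  rewrite lee_fin powR1 invrN mulrN -mulNr opprB mulrC ler_piMr// ?invr_ge0; first lra.
  by rewrite gerBl powR_ge0.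
exact: mp.
Qed.

(** The bound on [a, b] is uniform: exhaust the half-line by the segments
[1/(n+1), n+1]. *)
Lemma integral_incr_kernel_pos (s : R) : 0 < s < 1 ->
  (\int[mu]_(t in `]0%R, +oo[) (incr_kernel s t)%:E <= (incr_kernel_mass s)%:E)%E.
Proof.
move=> s01.
pose F n : set R := `[n.+1%:R^-1, n.+1%:R]%classic.
have UF : \bigcup_n F n = `]0, +oo[%classic.
  apply/seteqP; split => [t [n _]|t]; rewrite /F/= !in_itv/= andbT.
    by move=> /andP[+ _]; apply: lt_le_trans; rewrite invr_gt0.
  (* A rank beyond both t and 1 / t. *)
  move=> t0; pose n := (Num.truncn t + Num.truncn t^-1)%N.
  have t1 : t < n.+1%:R.
    apply: (lt_le_trans (truncnS_gt _)); rewrite ler_nat ltnS; exact: leq_addr.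
  have t2 : t^-1 < n.+1%:R.
    apply: (lt_le_trans (truncnS_gt _)); rewrite ler_nat ltnS; exact: leq_addl.
  exists n => //; rewrite /F /= in_itv/= (ltW t1) andbT.
  by rewrite -[leRHS]invrK lef_pV2 ?posrE ?invr_gt0// ltW.
have ndF : nondecreasing_seq F.
  move=> m n mn; apply/subsetPset => t; rewrite /F/= !in_itv/= => /andP[h1 h2].
  have mn' : m.+1%:R <= n.+1%:R :> R by rewrite ler_nat.
  rewrite (le_trans h2)// andbT (le_trans _ h1)// lef_pV2// posrE ltr0n//.
have mF n : measurable (F n) by exact: measurable_itv.
have := @ge0_nondecreasing_set_cvg_integral _ (measurableTypeR R) _ F (fun t => (incr_kernel s t)%:E) mu ndF mF.
rewrite UF => H.
have mg : measurable_fun setT (fun t => (incr_kernel s t)%:E).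
  by apply/measurable_EFinP; exact: measurable_incr_kernel.
have {}H := H (fun n => measurable_funTS mg)
  (fun n t _ => incr_kernel_ge0 s t : (0 <= (incr_kernel s t)%:E)%E).
rewrite -(cvg_lim _ H)//; apply: lime_le; first by apply/cvg_ex; eexists; exact: H.
apply: nearW => n; apply: integral_incr_kernel_itv => //.
- by rewrite invf_le1// ler1n.
- by rewrite ler1n.
Qed.

Lemma integral_incr_kernel (s : R) : 0 < s < 1 ->
  (\int[mu]_t (incr_kernel s t)%:E <= (2 * incr_kernel_mass s)%:E)%E.
Proof.
move=> s01.
pose kp : R -> \bar R := (fun t => (incr_kernel s t)%:E) \_ `]0%R, +oo[%classic.
have mkp : measurable_fun setT kp.
  apply/measurable_restrict => //; apply: measurable_funTS.
  by apply/measurable_EFinP; exact: measurable_incr_kernel.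
have kp0 t : (0 <= kp t)%E.
  by rewrite /kp patchE; case: ifP => // _; rewrite lee_fin incr_kernel_ge0.
have mkpN : measurable_fun setT (fun t : R => kp (0 - t)).
  exact: (measurableT_comp mkp (measurable_subl 0)).
apply: (@le_trans _ _ (\int[mu]_t (kp t + kp (0 - t)%R))%E).
  apply: ge0_le_integral => //.
  - by move=> t _; rewrite lee_fin incr_kernel_ge0.
  - by apply/measurable_EFinP; exact: measurable_incr_kernel.
  - exact: emeasurable_funD.
  - move=> t _; rewrite /kp !patchE !mem_setE !in_itv/= !andbT sub0r oppr_gt0 incr_kernelN.
    (* At t = 0 the kernel vanishes, as min(0, 4) = 0. *)
    have [t0|t0|<-] := ltgtP 0 t; rewrite ?adde0 ?add0e//.
    by rewrite /incr_kernel expr0n/= min_l ?mulr0 ?ler0n.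
rewrite ge0_integralD// ge0_integral_subl//.
rewrite -integral_mkcond mulr_natl mulr2n EFinD.
by rewrite leeD// integral_incr_kernel_pos.
Qed.


Lemma measurable_increment (u : R -> R) (t : R) : measurable_fun setT u ->
  measurable_fun setT (fun x : R => u (x + t) - u x).
Proof. by move=> mu_; apply: measurable_funB => //; exact: measurable_shift. Qed.

(** The bound by t^2 is the mean value inequality in L^2; the bound by 4 is
the triangle inequality. *)
Lemma sqnorm_increment_min (u g : R -> R) (t : R) : wderiv u g ->
  (sqnorm (fun x => u (x + t)%R - u x)%R <=
   (Num.min (t ^+ 2) 4)%:E * (sqnorm u + sqnorm g))%E.
Proof.
move=> ug; have [uL gL _] := ug; have mu_ := L2_measurable uL.
have H1 : (sqnorm (fun x => u (x + t)%R - u x)%R <= (t ^+ 2)%:E * sqnorm g)%E.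
  have [t0|t0] := leP 0 t; first exact: sqnorm_increment.
  have Nt0 : 0 <= - t by lra.
  rewrite -sqrrN; apply: le_trans (sqnorm_increment Nt0 ug).
  rewrite -(sqnorm_shift (- t) (measurable_increment t mu_)) -sqnormN.
  by under eq_fun do rewrite subrK opprB.
have H2 : (sqnorm (fun x => u (x + t)%R - u x)%R <= 4%:E * sqnorm u)%E.
  apply: (le_trans (sqnormD_le (measurable_shift t mu_) (measurableT_comp (@oppr_measurable R setT) mu_))).
  have -> : 4%:E = (2%:E * 2%:E)%E :> \bar R by rewrite -EFinM; congr EFin; ring.
  rewrite sqnorm_shift// (sqnormN u) -muleA lee_wpmul2l ?lee_fin//.
  by rewrite mule_natl mule2n.
rewrite ge0_muleDr ?sqnorm_ge0//.
case: (leP (t ^+ 2) 4) => h.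
  by apply: (le_trans H1); rewrite leeDr// mule_ge0 ?sqnorm_ge0// lee_fin sqr_ge0.
by apply: (le_trans H2); rewrite leeDl// mule_ge0 ?sqnorm_ge0// lee_fin.
Qed.

Definition gagliardo_quot (s : R) (u : R -> R) (z : R * R) : \bar R :=
  ((u z.1 - u z.2) ^+ 2 / (`|z.1 - z.2| `^ (1 + 2 * s)))%:E.

Lemma gagliardo_quot_ge0 s u z : (0 <= gagliardo_quot s u z)%E.
Proof. by rewrite lee_fin divr_ge0 ?sqr_ge0 ?powR_ge0. Qed.

Lemma measurable_gagliardo_quot (s : R) (u : R -> R) : measurable_fun setT u ->
  measurable_fun setT (gagliardo_quot s u).
Proof.
move=> mu_; apply/measurable_EFinP.
have -> : (fun z : R * R => (u z.1 - u z.2) ^+ 2 / `|z.1 - z.2| `^ (1 + 2 * s)) =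
    (fun z => (u z.1 - u z.2) ^+ 2 * `|z.1 - z.2| `^ (- (1 + 2 * s))).
  by apply/funext => z; rewrite powRN.
apply: measurable_funM.
  apply: measurable_funX; apply: measurable_funB.
    exact: (measurableT_comp mu_ measurable_fst).
  exact: (measurableT_comp mu_ measurable_snd).
apply: (measurableT_comp (measurable_powR _)); apply: measurableT_comp => //.
by apply: measurable_funB; [exact: measurable_fst|exact: measurable_snd].
Qed.

Lemma measurable_gagliardo_inner (s : R) (u : R -> R) : measurable_fun setT u ->
  measurable_fun setT (fun x => \int[mu]_y gagliardo_quot s u (x, y))%E.
Proof.
move=> /(measurable_gagliardo_quot s) m.
exact: (measurable_fun_fubini_tonelli_F (m2 := mu) _ m (gagliardo_quot_ge0 s u)).
Qed.

Lemma measurable_gagliardo_section (s : R) (u : R -> R) (x : R) :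
  measurable_fun setT u ->
  measurable_fun setT (fun y => gagliardo_quot s u (x, y)).
Proof.
move=> /(measurable_gagliardo_quot s) m.
by apply: (measurableT_comp m); exact: pair1_measurable.
Qed.

(** In the variables x and t = y - x the double integral is that of the
Gagliardo weight against the squared L^2 norms of the increments, each of
which is bounded by [sqnorm_increment_min]. *)
Lemma gagliardo_le (s : R) (u g : R -> R) : 0 < s < 1 -> wderiv u g ->
  (\int[mu]_x \int[mu]_y gagliardo_quot s u (x, y) <= (2 * incr_kernel_mass s)%:E * (sqnorm u + sqnorm g))%E.
Proof.
move=> s01 ug; have [uL gL _] := ug; have mu_ := L2_measurable uL.
pose N := (sqnorm u + sqnorm g)%E.
have N0 : (0 <= N)%E by rewrite adde_ge0 ?sqnorm_ge0.
pose K (t : R) := `|t| `^ (- (1 + 2 * s)).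
have mK : measurable_fun setT K.
  by apply: (measurableT_comp (measurable_powR _)); exact: normr_measurable.
pose H (z : R * R) := (K z.2 * (u (z.1 + z.2) - u z.1) ^+ 2)%:E.
have mH : measurable_fun setT H.
  apply/measurable_EFinP; apply: measurable_funM.
    exact: (measurableT_comp mK measurable_snd).
  apply: measurable_funX; apply: measurable_funB.
    apply: (measurableT_comp mu_); apply: measurable_funD;
      [exact: measurable_fst|exact: measurable_snd].
  exact: (measurableT_comp mu_ measurable_fst).
have H0 z : (0 <= H z)%E by rewrite lee_fin mulr_ge0 ?powR_ge0 ?sqr_ge0.
have -> : (\int[mu]_x \int[mu]_y gagliardo_quot s u (x, y)
   = \int[mu]_x \int[mu]_t H (x, t))%E.
  apply: eq_integral => x _.
  rewrite -[LHS](@ge0_integral_shift _ x).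
  - apply: eq_integral => t _; rewrite /gagliardo_quot /H /K/= powRN mulrC;
    congr (_ * _)%:E.
      by rewrite (addrC t) opprD addNKr normrN.
    by rewrite -sqrrN opprB (addrC t).
  - exact: measurable_gagliardo_section.
  - by move=> y; exact: gagliardo_quot_ge0.
rewrite (fubini_tonelli (m1 := mu) (m2 := mu) _ mH H0).
apply: (@le_trans _ _ (\int[mu]_t ((incr_kernel s t)%:E * N))%E).
  apply: ge0_le_integral => //.
  - by move=> t _; apply: integral_ge0.
  - exact: (measurable_fun_fubini_tonelli_G (m1 := mu) _ mH H0).
  - by apply: emeasurable_funM => //; apply/measurable_EFinP;
    exact: measurable_incr_kernel.
  - move=> t _; rewrite /H/=; under eq_integral do rewrite EFinM.
    rewrite ge0_integralZl//.
    + rewrite /incr_kernel EFinM -muleA lee_wpmul2l ?lee_fin ?powR_ge0//.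
      exact: sqnorm_increment_min.
    + by apply: measurable_sqr; exact: measurable_increment.
    + by move=> x _; rewrite lee_fin sqr_ge0.
    + by rewrite lee_fin powR_ge0.
rewrite ge0_integralZr//.
- by rewrite lee_wpmul2r// integral_incr_kernel.
- by apply/measurable_EFinP; exact: measurable_incr_kernel.
- by move=> t _; rewrite lee_fin incr_kernel_ge0.
Qed.

End Gagliardo.

(** * Algebra and uniqueness of weak derivatives *)

Section WeakDerivativeAlgebra.
Variable R : realType.
Local Notation mu := (@lebesgue_measure R).
Local Notation L2 := (Lfun mu 2%:E).
Implicit Types u v g h a b : R -> R.

Lemma wderivD u v g h : wderiv u g -> wderiv v h ->
  wderiv (fun x => u x + v x) (fun x => g x + h x).
Proof.
move=> [uL gL ug] [vL hL vh]; split; [exact: L2D|exact: L2D|move=> phi tphi].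
have pL := test_L2 tphi; have dL := derive1_test_L2 tphi.
under eq_Rintegral do rewrite mulrDl.
rewrite RintegralD//; [|exact: L2_mul_integrable|exact: L2_mul_integrable].
under [X in _ = - X]eq_Rintegral do rewrite mulrDl.
rewrite RintegralD//; [|exact: L2_mul_integrable|exact: L2_mul_integrable].
by rewrite ug// vh// opprD.
Qed.

Lemma wderivZ (c : R) u g : wderiv u g ->
  wderiv (fun x => c * u x) (fun x => c * g x).
Proof.
move=> [uL gL ug]; split; [exact: L2Z|exact: L2Z|move=> phi tphi].
have pL := test_L2 tphi; have dL := derive1_test_L2 tphi.
under eq_Rintegral do rewrite -mulrA.
rewrite RintegralZl//; last exact: L2_mul_integrable.
under [X in _ = - X]eq_Rintegral do rewrite -mulrA.
by rewrite RintegralZl// ?ug ?mulrN//; exact: L2_mul_integrable.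
Qed.

Lemma L2_0 : (fun _ : R => 0 : R) \in L2.
Proof.
apply/Lfun2P; split; first exact: measurable_cst.
by under eq_integral do rewrite expr0n/=; rewrite integral0.
Qed.

Lemma wderiv0 : wderiv (fun _ : R => 0 : R) (fun _ : R => 0 : R).
Proof.
split; [exact: L2_0|exact: L2_0|move=> phi _].
have E (psi : R -> R) : \int[mu]_x (0 * psi x) = 0.
  by under eq_Rintegral do rewrite mul0r; rewrite Rintegral_cst// mul0r.
by rewrite !E oppr0.
Qed.

Lemma wderiv_sum m (u g : 'I_m -> R -> R) : (forall j, wderiv (u j) (g j)) ->
  wderiv (fun x => \sum_(j < m) u j x) (fun x => \sum_(j < m) g j x).
Proof.
elim: m u g => [|m IH] u g ug.
  under eq_fun do rewrite big_ord0; under [X in wderiv _ X]eq_fun do rewrite big_ord0.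
  exact: wderiv0.
under eq_fun do rewrite big_ord_recl.
under [X in wderiv _ X]eq_fun do rewrite big_ord_recl.
by apply: wderivD => //; apply: IH.
Qed.

(** The derivative a' is a parameter, as the coefficients of interest come
with a formula for it. *)
Definition C1_bounded (a a' : R -> R) : Prop :=
  [/\ forall x : R, is_derive x 1 a (a' x), continuous a' &
      exists M, forall x, `|a x| <= M /\ `|a' x| <= M].

Lemma C1_bounded_continuous a a' : C1_bounded a a' -> continuous a.
Proof.
move=> [da _ _] x; apply: differentiable_continuous; apply/derivable1_diffP.
by have [] := da x.
Qed.

Lemma C1_mul_test a a' phi : C1_bounded a a' -> test_function phi ->
  test_function (fun x => a x * phi x) /\
  forall x, derive1 (fun x => a x * phi x) x = a' x * phi x + a x * derive1 phi x.
Proof.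
move=> C1; have [da ca' _] := C1; move=> tphi; have [dphi cphi [M hM]] := tphi.
have d (x : R) : is_derive x 1 (fun x => a x * phi x) (a' x * phi x + a x * derive1 phi x).
  have h := da x.
  have hp : is_derive x 1 phi (derive1 phi x).
    by apply: DeriveDef; [exact: dphi|rewrite derive1E].
  by apply: is_derive_eq; rewrite /GRing.scale/= addrC mulrC; congr (_ + _); ring.
have E x : derive1 (fun x => a x * phi x) x = a' x * phi x + a x * derive1 phi x.
  by rewrite derive1E; have [_ ->] := d x.
split => //; split.
- by move=> x; have [] := d x.
- have -> : derive1 (fun x => a x * phi x) = (fun x => a' x * phi x + a x * derive1 phi x).
    by apply/funext.
  move=> x; apply: cvgD; apply: cvgM.
  + exact: ca'.
  + exact: (test_continuous tphi).
  + exact: (C1_bounded_continuous C1).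
  + exact: cphi.
- by exists M => x /hM ->; rewrite mulr0.
Qed.

(** The product of a and a test function is a test function; test the weak
derivative of u against it. *)
Lemma wderivM a a' u g : C1_bounded a a' -> wderiv u g ->
  wderiv (fun x => a x * u x) (fun x => a' x * u x + a x * g x).
Proof.
move=> C1 [uL gL ug]; have ca := C1_bounded_continuous C1; have [_ ca' [M hM]] := C1.
have ma := continuous_measurable_fun ca; have ma' := continuous_measurable_fun ca'.
have auL : (fun x => a x * u x) \in L2.
  by apply: (L2_bmul ma _ uL) => x; have [] := hM x; eauto.
have agL : (fun x => a x * g x) \in L2.
  by apply: (L2_bmul ma _ gL) => x; have [] := hM x; eauto.
have a'uL : (fun x => a' x * u x) \in L2.
  by apply: (L2_bmul ma' _ uL) => x; have [] := hM x; eauto.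
split => //; first exact: L2D.
move=> phi tphi; have [tap dE] := C1_mul_test C1 tphi.
have pL := test_L2 tphi; have dL := derive1_test_L2 tphi.
have i1 := L2_mul_integrable auL dL; have i2 := L2_mul_integrable a'uL pL.
have i3 := L2_mul_integrable agL pL.
under [X in _ = - X]eq_Rintegral do rewrite mulrDl.
rewrite RintegralD//.
have := ug _ tap.
under eq_Rintegral do rewrite dE mulrDr mulrCA mulrA [_ * (a _ * _)]mulrCA mulrA.
rewrite RintegralD//.
under [X in _ = - X -> _]eq_Rintegral do rewrite mulrCA mulrA.
by lra.
Qed.

Lemma ae_eqL2_integral u v phi : {ae mu, forall x, u x = v x} ->
  measurable_fun setT u -> measurable_fun setT v -> measurable_fun setT phi ->
  \int[mu]_x (u x * phi x) = \int[mu]_x (v x * phi x).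
Proof.
move=> uv mu_ mv mp; rewrite /Rintegral; congr fine; apply: ae_eq_integral => //.
- by apply/measurable_EFinP; exact: measurable_funM.
- by apply/measurable_EFinP; exact: measurable_funM.
- move: uv; apply: filterS; first exact: (ae_filter_ringOfSetsType mu).
  by move=> x -> _.
Qed.

Lemma wderiv_ae u v g h : wderiv u g ->
  {ae mu, forall x, u x = v x} -> {ae mu, forall x, g x = h x} ->
  v \in L2 -> h \in L2 -> wderiv v h.
Proof.
move=> [uL gL ug] uv gh vL hL; split => // phi tphi.
have pL := test_L2 tphi; have dL := derive1_test_L2 tphi.
have E1 := ae_eqL2_integral uv (L2_measurable uL) (L2_measurable vL) (L2_measurable dL).
have E2 := ae_eqL2_integral gh (L2_measurable gL) (L2_measurable hL) (L2_measurable pL).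
by rewrite -E1 -E2 ug.
Qed.

(** The difference of two weak derivatives is orthogonal to all test
functions. *)
Lemma wderiv_uniq u g h : wderiv u g -> wderiv u h -> {ae mu, forall x, g x = h x}.
Proof.
move=> [uL gL ug] [_ hL uh].
have NhL := L2Z (-1) hL.
have := fundamental_lemma (L2D gL NhL) _.
have H : orthogonal_to_tests (fun x => g x + -1 * h x).
  move=> phi tphi; have pL := test_L2 tphi.
  under eq_Rintegral do rewrite mulrDl -mulrA.
  rewrite RintegralD//; last 2 first.
  - exact: L2_mul_integrable.
  - have := L2_mul_integrable NhL pL.
    by apply: eq_integrable => // x _; rewrite /= -?mulrA.
  rewrite RintegralZl//; last exact: L2_mul_integrable.
  by have := ug _ tphi; have := uh _ tphi; lra.
move/(_ H); apply: filterS; first exact: (ae_filter_ringOfSetsType mu).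
by move=> x; lra.
Qed.

End WeakDerivativeAlgebra.

(** * Complex vector-valued functions *)

Section Vectors.
Variables (R : realType) (n : nat).
Local Notation mu := (@lebesgue_measure R).
Local Notation L2 := (Lfun mu 2%:E).
Local Notation vfun := (R -> 'cV[R[i]]_n).
Implicit Types h g : vfun.

Lemma ReD (x y : R[i]) : complex.Re (x + y) = complex.Re x + complex.Re y.
Proof. by case: x; case: y. Qed.
Lemma ImD (x y : R[i]) : complex.Im (x + y) = complex.Im x + complex.Im y.
Proof. by case: x; case: y. Qed.
Lemma ReM (x y : R[i]) : complex.Re (x * y) =
  complex.Re x * complex.Re y - complex.Im x * complex.Im y.
Proof. by case: x; case: y. Qed.
Lemma ImM (x y : R[i]) : complex.Im (x * y) =
  complex.Re x * complex.Im y + complex.Im x * complex.Re y.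
Proof. by case: x; case: y. Qed.
Lemma Re_sum m (F : 'I_m -> R[i]) :
  complex.Re (\sum_j F j) = \sum_j complex.Re (F j).
Proof. exact: (big_morph _ ReD). Qed.
Lemma Im_sum m (F : 'I_m -> R[i]) :
  complex.Im (\sum_j F j) = \sum_j complex.Im (F j).
Proof. exact: (big_morph _ ImD). Qed.

Definition sqmod (z : R[i]) : R := complex.Re z ^+ 2 + complex.Im z ^+ 2.

Lemma sqmod_ge0 z : 0 <= sqmod z.
Proof. by rewrite addr_ge0 ?sqr_ge0. Qed.

Lemma sqmodM (x y : R[i]) : sqmod (x * y) = sqmod x * sqmod y.
Proof. rewrite /sqmod ReM ImM; ring. Qed.

Lemma sqmodD_le (x y : R[i]) : sqmod (x + y) <= 2 * (sqmod x + sqmod y).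
Proof.
rewrite /sqmod ReD ImD.
have := sqr_ge0 (complex.Re x - complex.Re y).
have := sqr_ge0 (complex.Im x - complex.Im y); nra.
Qed.

Definition sqlen m (z : 'cV[R[i]]_m) : R := \sum_(i < m) sqmod (z i ord0).

Lemma sqlen_ge0 m (z : 'cV[R[i]]_m) : 0 <= sqlen z.
Proof. by apply: sumr_ge0 => i _; exact: sqmod_ge0. Qed.

Lemma cvnorm_sqr m (z : 'cV[R[i]]_m) : cvnorm z ^+ 2 = sqlen z.
Proof.
rewrite /cvnorm sqr_sqrtr; last by apply: sumr_ge0 => i _; exact: sqr_ge0.
apply: eq_bigr => i _; case: (z i ord0) => a b /=.
by rewrite sqr_sqrtr// addr_ge0 ?sqr_ge0.
Qed.

Lemma sqlenD_le m (y z : 'cV[R[i]]_m) : sqlen (y + z) <= 2 * (sqlen y + sqlen z).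
Proof.
rewrite /sqlen -big_split/= mulr_sumr; apply: ler_sum => i _.
by rewrite mxE; exact: sqmodD_le.
Qed.

Lemma sqlenZ m (c : R[i]) (z : 'cV[R[i]]_m) : sqlen (c *: z) = sqmod c * sqlen z.
Proof.
by rewrite /sqlen mulr_sumr; apply: eq_bigr => i _; rewrite mxE sqmodM.
Qed.

(** The weighted inequality 2 x y <= a x^2 + y^2 / a. *)
Let sqrD_weighted (a x y z : R) : 0 < a -> y ^+ 2 <= a * z ->
  (x + y) ^+ 2 <= (1 + a) * (x ^+ 2 + z).
Proof.
move=> a0 H.
have h1 : 2 * x * y <= a * x ^+ 2 + a^-1 * y ^+ 2.
  rewrite -subr_ge0 (_ : _ - _ = a^-1 * (a * x - y) ^+ 2).
    by rewrite mulr_ge0 ?sqr_ge0 ?invr_ge0 ?ltW.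
  by field; rewrite gt_eqF.
have h2 : a^-1 * y ^+ 2 <= z by rewrite ler_pdivrMl.
nra.
Qed.

Lemma sqr_sum_le m (F : 'I_m -> R) : (\sum_j F j) ^+ 2 <= m%:R * \sum_j F j ^+ 2.
Proof.
elim: m F => [|m IH] F; first by rewrite !big_ord0 expr0n mulr0.
rewrite !big_ord_recl.
case: m IH F => [|m] IH F; first by rewrite !big_ord0 !addr0 mul1r.
by rewrite [m.+2%:R]mulrS; apply: sqrD_weighted; rewrite ?ltr0n.
Qed.

Lemma sqlen_mul_le m (B : 'M[R]_m) (M : R) (z : 'cV[R[i]]_m) :
  (forall i j, `|B i j| <= M) ->
  sqlen (map_mx (real_complex R) B *m z) <= (m%:R * m%:R * M ^+ 2) * sqlen z.
Proof.
move=> BM.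
have H i : sqmod ((map_mx (real_complex R) B *m z) i ord0) <= m%:R * M ^+ 2 * sqlen z.
  have e : sqmod ((map_mx (real_complex R) B *m z) i ord0) =
     (\sum_j B i j * complex.Re (z j ord0)) ^+ 2 +
     (\sum_j B i j * complex.Im (z j ord0)) ^+ 2.
    rewrite /sqmod mxE Re_sum Im_sum.
    by congr (_ ^+ 2 + _ ^+ 2); apply: eq_bigr => j _;
      rewrite ?mxE ?ReM ?ImM/= mul0r ?subr0 ?addr0.
  rewrite e; apply: (le_trans (lerD (sqr_sum_le _) (sqr_sum_le _))).
  rewrite -mulrDr -mulrA ler_wpM2l// -big_split/= /sqlen mulr_sumr.
  apply: ler_sum => j _; rewrite !exprMn -mulrDr ler_wpM2r ?sqmod_ge0//.
  rewrite -real_normK ?num_real//.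
  by rewrite lerXn2r ?nnegrE// (le_trans _ (BM i j)).
apply: (le_trans (ler_sum _ (fun i _ => H i))).
by rewrite sumr_const card_ord -[leLHS]mulr_natl !mulrA.
Qed.

Definition L2sq h : \bar R := (\int[mu]_x (sqlen (h x))%:E)%E.

Lemma L2normE h : L2norm h = (L2sq h `^ 2^-1)%E.
Proof.
rewrite /L2norm (Lnorm2E (fun x => cvnorm (h x))); congr (_ `^ _)%E.
by apply: eq_integral => x _; rewrite cvnorm_sqr.
Qed.

Lemma L2sq_ge0 h : (0 <= L2sq h)%E.
Proof. by apply: integral_ge0 => x _; rewrite lee_fin sqlen_ge0. Qed.

Lemma reC_D h g i : reC (fun x => h x + g x) i = (fun x => reC h i x + reC g i x).
Proof. by apply/funext => x; rewrite /reC mxE ReD. Qed.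
Lemma imC_D h g i : imC (fun x => h x + g x) i = (fun x => imC h i x + imC g i x).
Proof. by apply/funext => x; rewrite /imC mxE ImD. Qed.
Lemma reC_Z c h i : reC (fun x => c *: h x) i =
  (fun x => complex.Re c * reC h i x + (- complex.Im c) * imC h i x).
Proof. by apply/funext => x; rewrite /reC mxE ReM mulNr. Qed.
Lemma imC_Z c h i : imC (fun x => c *: h x) i =
  (fun x => complex.Re c * imC h i x + complex.Im c * reC h i x).
Proof. by apply/funext => x; rewrite /imC mxE ImM. Qed.

Lemma inL2_measurable h i : inL2 h ->
  measurable_fun setT (reC h i) /\ measurable_fun setT (imC h i).
Proof. by move=> /(_ i) [/L2_measurable ? /L2_measurable ?]. Qed.

Lemma measurable_sqlen h : inL2 h -> measurable_fun setT (fun x => (sqlen (h x))%:E).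
Proof.
move=> hL; apply/measurable_EFinP; rewrite /sqlen.
apply: (measurable_sum _ (h := fun i x => sqmod (h x i ord0))) => i.
have [m1 m2] := inL2_measurable i hL.
by apply: measurable_funD; apply: measurable_funX.
Qed.

Lemma L2sqE h : inL2 h ->
  L2sq h = (\sum_(i < n) (sqnorm (reC h i) + sqnorm (imC h i)))%E.
Proof.
move=> hL; rewrite /L2sq.
under eq_integral do rewrite /sqlen -sumEFin.
rewrite ge0_integral_sum//.
- apply: eq_bigr => i _; have [m1 m2] := inL2_measurable i hL.
  under eq_integral do rewrite EFinD.
  by rewrite ge0_integralD//; try (move=> x _; rewrite lee_fin sqr_ge0//);
    exact: measurable_sqr.
- move=> i; have [m1 m2] := inL2_measurable i hL.
  by apply/measurable_EFinP; apply: measurable_funD; exact: measurable_funX.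
- by move=> i x _; rewrite lee_fin sqmod_ge0.
Qed.

Lemma inL2_D h g : inL2 h -> inL2 g -> inL2 (fun x => h x + g x).
Proof.
move=> hL gL i; have [? ?] := hL i; have [? ?] := gL i.
by rewrite reC_D imC_D; split; exact: L2D.
Qed.

Lemma inL2_Z c h : inL2 h -> inL2 (fun x => c *: h x).
Proof.
move=> hL i; have [? ?] := hL i.
by rewrite reC_Z imC_Z; split; apply: L2D; exact: L2Z.
Qed.

Lemma weak_derivE h g : weak_deriv h g <->
  forall i, wderiv (reC h i) (reC g i) /\ wderiv (imC h i) (imC g i).
Proof.
split=> [[hL gL H] i|H].
  have [? ?] := hL i; have [? ?] := gL i.
  by split; split => // phi tphi; have [] := H phi tphi i.
split.
- by move=> i; have [[? ? _] [? ? _]] := H i.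
- by move=> i; have [[? ? _] [? ? _]] := H i.
- by move=> phi tphi i; have [[? ? h1] [? ? h2]] := H i; split; [exact: h1|exact: h2].
Qed.

Lemma weak_deriv_D h h' g g' : weak_deriv h h' -> weak_deriv g g' ->
  weak_deriv (fun x => h x + g x) (fun x => h' x + g' x).
Proof.
move=> /weak_derivE H /weak_derivE G; apply/weak_derivE => i.
have [? ?] := H i; have [? ?] := G i; rewrite !reC_D !imC_D.
by split; exact: wderivD.
Qed.

Lemma weak_deriv_Z c h g : weak_deriv h g ->
  weak_deriv (fun x => c *: h x) (fun x => c *: g x).
Proof.
move=> /weak_derivE H; apply/weak_derivE => i.
have [? ?] := H i; rewrite !reC_Z !imC_Z.
by split; apply: wderivD; exact: wderivZ.
Qed.

Lemma ae_comp h g : {ae mu, forall x, h x = g x} ->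
  forall i, {ae mu, forall x, reC h i x = reC g i x} /\
            {ae mu, forall x, imC h i x = imC g i x}.
Proof.
move=> H i; split; move: H; (apply: filterS;
  first exact: (ae_filter_ringOfSetsType mu));
  by move=> x; rewrite /reC /imC => ->.
Qed.

Lemma ae_of_comp h g :
  (forall i, {ae mu, forall x, reC h i x = reC g i x} /\
            {ae mu, forall x, imC h i x = imC g i x}) ->
  {ae mu, forall x, h x = g x}.
Proof.
move=> H.
have H1 : \forall x \ae mu, forall k : nat, forall i : 'I_n, val i = k ->
    reC h i x = reC g i x /\ imC h i x = imC g i x.
  apply/ae_foralln => k; case: (ltnP k n) => kn; last first.
    by apply: aeW => x i ik; move: (ltn_ord i); rewrite ik ltnNge kn.
  have [h1 h2] := H (Ordinal kn).
  move: h1 h2; apply: filterS2; first exact: (ae_filter_ringOfSetsType mu).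
  by move=> x e1 e2 i ik; have -> : i = Ordinal kn by exact: val_inj.
move: H1; apply: filterS; first exact: (ae_filter_ringOfSetsType mu).
move=> x hx; apply/colP => i; move: (hx i i erefl); rewrite /reC /imC.
by case: (h x i ord0) => a b; case: (g x i ord0) => c d /= [-> ->].
Qed.

Lemma weak_deriv_uniq h g g' : weak_deriv h g -> weak_deriv h g' ->
  {ae mu, forall x, g x = g' x}.
Proof.
move=> /weak_derivE H /weak_derivE G; apply: ae_of_comp => i.
have [h1 h2] := H i; have [g1 g2] := G i.
by split; [exact: wderiv_uniq h1 g1|exact: wderiv_uniq h2 g2].
Qed.

Lemma weak_deriv_ae h h' g g' : weak_deriv h g ->
  {ae mu, forall x, h x = h' x} -> {ae mu, forall x, g x = g' x} ->
  inL2 h' -> inL2 g' -> weak_deriv h' g'.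
Proof.
move=> /weak_derivE H hh gg hL gL; apply/weak_derivE => i.
have [h1 h2] := H i; have [e1 e2] := ae_comp hh i; have [e3 e4] := ae_comp gg i.
have [? ?] := hL i; have [? ?] := gL i.
by split; [exact: wderiv_ae h1 e1 e3 _ _|exact: wderiv_ae h2 e2 e4 _ _].
Qed.

Lemma weak_deriv_wD h : (exists g, weak_deriv h g) -> weak_deriv h (wD h).
Proof. by case=> g hg; rewrite /wD; case: xgetP => [g' -> //|/(_ g)]. Qed.

Lemma L2sq_ae h g : inL2 h -> inL2 g -> {ae mu, forall x, h x = g x} -> L2sq h = L2sq g.
Proof.
move=> hL gL hg; apply: ae_eq_integral => //;
  [exact: measurable_sqlen|exact: measurable_sqlen|].
move: hg; apply: filterS; first exact: (ae_filter_ringOfSetsType mu).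
by move=> x -> _.
Qed.

Lemma L2sq_le (K : R) h g : inL2 h -> inL2 g -> 0 <= K ->
  (forall x, sqlen (h x) <= K * sqlen (g x)) -> (L2sq h <= K%:E * L2sq g)%E.
Proof.
move=> hL gL K0 H; rewrite /L2sq -ge0_integralZl//.
- apply: ge0_le_integral => //.
  + by move=> x _; rewrite lee_fin sqlen_ge0.
  + exact: measurable_sqlen.
  + by apply: measurable_funeM; exact: measurable_sqlen.
  + by move=> x _; rewrite -EFinM lee_fin.
- exact: measurable_sqlen.
- by move=> x _; rewrite lee_fin sqlen_ge0.
Qed.

Lemma L2sqD_le h g : inL2 h -> inL2 g ->
  (L2sq (fun x => (h x + g x)%R) <= 2%:E * (L2sq h + L2sq g))%E.
Proof.
move=> hL gL; have mh := measurable_sqlen hL; have mg := measurable_sqlen gL.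
rewrite /L2sq -ge0_integralD//; try by move=> x _; rewrite lee_fin sqlen_ge0.
rewrite -ge0_integralZl//.
- apply: ge0_le_integral => //.
  + by move=> x _; rewrite lee_fin sqlen_ge0.
  + by apply: measurable_sqlen; exact: inL2_D.
  + by apply: measurable_funeM; exact: emeasurable_funD.
  + by move=> x _; rewrite -EFinD -EFinM lee_fin sqlenD_le.
- exact: emeasurable_funD.
- by move=> x _; rewrite -EFinD lee_fin addr_ge0 ?sqlen_ge0.
Qed.

Definition C1_bounded_mx (B B' : R -> 'M[R]_n) : Prop :=
  forall i j, C1_bounded (fun x => B x i j) (fun x => B' x i j).

Lemma reC_mul (B : R -> 'M[R]_n) h i :
  reC (fun x => map_mx (real_complex R) (B x) *m h x) i =
  (fun x => \sum_j B x i j * reC h j x).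
Proof.
apply/funext => x; rewrite /reC mxE Re_sum; apply: eq_bigr => j _.
by rewrite mxE ReM/= mul0r subr0.
Qed.

Lemma imC_mul (B : R -> 'M[R]_n) h i :
  imC (fun x => map_mx (real_complex R) (B x) *m h x) i =
  (fun x => \sum_j B x i j * imC h j x).
Proof.
apply/funext => x; rewrite /imC mxE Im_sum; apply: eq_bigr => j _.
by rewrite mxE ImM/= mul0r addr0.
Qed.

Lemma weak_deriv_mul (B B' : R -> 'M[R]_n) h g : C1_bounded_mx B B' -> weak_deriv h g ->
  weak_deriv (fun x => map_mx (real_complex R) (B x) *m h x)
    (fun x => map_mx (real_complex R) (B' x) *m h x + map_mx (real_complex R) (B x) *m g x).
Proof.
move=> C1 /weak_derivE H; apply/weak_derivE => i.
rewrite reC_D imC_D !reC_mul !imC_mul.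
split.
  under [X in wderiv _ X]eq_fun do rewrite -big_split/=.
  by apply: wderiv_sum => j; apply: wderivM; [exact: C1|have [] := H j].
under [X in wderiv _ X]eq_fun do rewrite -big_split/=.
by apply: wderiv_sum => j; apply: wderivM; [exact: C1|have [] := H j].
Qed.

Lemma L2_sum m (u : 'I_m -> R -> R) : (forall j, u j \in L2) ->
  (fun x => \sum_j u j x) \in L2.
Proof.
elim: m u => [|m IH] u uL.
  by under eq_fun do rewrite big_ord0; exact: L2_0.
under eq_fun do rewrite big_ord_recl.
by apply: L2D => //; apply: IH.
Qed.

Lemma inL2_mul (B B' : R -> 'M[R]_n) h : C1_bounded_mx B B' -> inL2 h ->
  inL2 (fun x => map_mx (real_complex R) (B x) *m h x).
Proof.
move=> C1 hL i; rewrite reC_mul imC_mul.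
have bL j (u : R -> R) : u \in L2 -> (fun x => B x i j * u x) \in L2.
  have [_ _ [M hM]] := C1 i j; move=> uL; apply: (L2_bmul _ _ uL).
    exact: (continuous_measurable_fun (C1_bounded_continuous (C1 i j))).
  by move=> x; have [] := hM x; eauto.
by split; apply: L2_sum => j; apply: bL; have [] := hL j.
Qed.

(** Apply [gagliardo_le] to the real and imaginary parts of all components. *)
Lemma gagliardo_sq_le (s : R) h g : 0 < s < 1 -> weak_deriv h g ->
  (gagliardo_sq s h <= (2 * incr_kernel_mass s)%:E * (L2sq h + L2sq g))%E.
Proof.
move=> s01 hg; have [hL gL _] := hg; move/weak_derivE: hg => H.
have H1 i := (H i).1; have H2 i := (H i).2.
have m1 i : measurable_fun setT (reC h i) by have [/L2_measurable] := H1 i.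
have m2 i : measurable_fun setT (imC h i) by have [/L2_measurable] := H2 i.
have -> : gagliardo_sq s h = (\sum_(i < n)
    (\int[mu]_x \int[mu]_y gagliardo_quot s (reC h i) (x, y) +
     \int[mu]_x \int[mu]_y gagliardo_quot s (imC h i) (x, y)))%E.
  transitivity (\int[mu]_x \sum_(i < n) (\int[mu]_y gagliardo_quot s (reC h i) (x, y) +
      \int[mu]_y gagliardo_quot s (imC h i) (x, y)))%E.
    apply: eq_integral => x _.
    transitivity (\int[mu]_y \sum_(i < n) (gagliardo_quot s (reC h i) (x, y) +
        gagliardo_quot s (imC h i) (x, y)))%E.
      apply: eq_integral => y _; rewrite cvnorm_sqr /sqlen mulr_suml -sumEFin.
      apply: eq_bigr => i _; rewrite -EFinD /= -mulrDl /sqmod !mxE ReD ImD.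
      by rewrite /reC /imC; case: (h y i ord0).
    rewrite ge0_integral_sum//.
    - apply: eq_bigr => i _; rewrite ge0_integralD//; try (by move=> y _;
      exact: gagliardo_quot_ge0);
        exact: measurable_gagliardo_section.
    - by move=> i; apply: emeasurable_funD; exact: measurable_gagliardo_section.
    - by move=> i y _; apply: adde_ge0; exact: gagliardo_quot_ge0.
  have I0 u x : (0 <= \int[mu]_y gagliardo_quot s u (x, y))%E.
    by apply: integral_ge0 => y _; exact: gagliardo_quot_ge0.
  rewrite ge0_integral_sum//.
  - apply: eq_bigr => i _; rewrite ge0_integralD//; exact: measurable_gagliardo_inner.
  - by move=> i; apply: emeasurable_funD; exact: measurable_gagliardo_inner.
  - by move=> i y _; apply: adde_ge0; exact: I0.
rewrite !L2sqE// -big_split/= ge0_sume_distrr; last first.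
  by move=> i _; apply: adde_ge0; apply: adde_ge0; exact: sqnorm_ge0.
apply: lee_sum => i _.
apply: (le_trans (leeD (gagliardo_le s01 (H1 i)) (gagliardo_le s01 (H2 i)))).
have S0 (u v : R -> R) : (0 <= sqnorm u + sqnorm v)%E.
  by apply: adde_ge0; exact: sqnorm_ge0.
by rewrite -ge0_muleDr// addeACA.
Qed.

End Vectors.

(** * Matrices with smooth bounded coefficients *)

Section SmoothMatrices.
Variable R : realType.

Lemma derivable_fctM (f g : R -> R) (x : R) : derivable f x 1 -> derivable g x 1 ->
  derivable (fun y => f y * g y) x 1.
Proof. exact: derivableM. Qed.

Lemma derivable_fctZ (c : R) (f : R -> R) (x : R) : derivable f x 1 ->
  derivable (fun y => c * f y) x 1.
Proof. by apply: derivable_fctM; exact: derivable_cst. Qed.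

Lemma derivable_bigsum (I : Type) (r : seq I) (P : pred I) (F : I -> R -> R) (x : R) :
  (forall i, derivable (F i) x 1) ->
  derivable (fun y => \sum_(i <- r | P i) F i y) x 1.
Proof.
move=> dF; elim: r => [|i r IH].
  by under eq_fun do rewrite big_nil; exact: derivable_cst.
under eq_fun do rewrite big_cons.
by case: (P i) => //; apply: (derivableD (f := F i)).
Qed.

Lemma derivable_bigprod (I : Type) (r : seq I) (P : pred I) (F : I -> R -> R) (x : R) :
  (forall i, derivable (F i) x 1) ->
  derivable (fun y => \prod_(i <- r | P i) F i y) x 1.
Proof.
move=> dF; elim: r => [|i r IH].
  by under eq_fun do rewrite big_nil; exact: derivable_cst.
under eq_fun do rewrite big_cons.
by case: (P i) => //; apply: (derivableM (f := F i)).
Qed.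

Lemma derivable_det m (A : R -> 'M[R]_m) (x : R) :
  (forall i j, derivable (fun y => A y i j) x 1) ->
  derivable (fun y => \det (A y)) x 1.
Proof.
move=> dA; rewrite /determinant; apply: derivable_bigsum => s.
apply: derivable_fctZ.
by apply: derivable_bigprod.
Qed.

Lemma derivable_mulmx m (A B : R -> 'M[R]_m) (x : R) :
  (forall i j, derivable (fun y => A y i j) x 1) ->
  (forall i j, derivable (fun y => B y i j) x 1) ->
  forall i j, derivable (fun y => (A y *m B y) i j) x 1.
Proof.
move=> dA dB i j; under eq_fun do rewrite mxE.
by apply: derivable_bigsum => k; apply: derivable_fctM.
Qed.

(** By the Cramer formula the entries of the inverse are polynomials in those
of A, divided by the determinant. *)
Lemma derivable_invmx m (A : R -> 'M[R]_m) (x : R) :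
  (forall y, A y \in unitmx) ->
  (forall i j, derivable (fun y => A y i j) x 1) ->
  forall i j, derivable (fun y => (invmx (A y)) i j) x 1.
Proof.
move=> uA dA i j.
have -> : (fun y => (invmx (A y)) i j) =
    (fun y => (\det (A y))^-1) * (fun y => cofactor (A y) j i).
  by apply/funext => y; rewrite /invmx uA !mxE.
apply: derivableM.
  apply: derivableV; last exact: derivable_det.
  by rewrite -unitfE -unitmxE.
rewrite /cofactor.
apply: derivable_fctZ.
apply: derivable_det => k l; under eq_fun do rewrite !mxE.
exact: dA.
Qed.

Lemma derive1_entry p q (A : R -> 'M[R]_(p, q)) (x : R) i j : derivable A x 1 ->
  is_derive x 1 (fun y => A y i j) (derive1 A x i j).
Proof.
move=> dA; have /derivable_mxP/(_ i j) dAij := dA.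
by apply: DeriveDef => //; rewrite derive1E derive_mx// mxE.
Qed.

Lemma entry_le_norm p q (A : 'M[R]_(p, q)) i j : `|A i j| <= `|A|.
Proof.
rewrite [leRHS]/Num.Def.normr/= mx_normrE.
exact: (@le_bigmax _ _ _ _ (fun ij => `|A ij.1 ij.2|) (i, j)).
Qed.

Lemma mul_entry_le m (A B : 'M[R]_m) a b i j : 0 <= a ->
  (forall i j, `|A i j| <= a) -> (forall i j, `|B i j| <= b) ->
  `|(A *m B) i j| <= m%:R * (a * b).
Proof.
move=> a0 hA hB; rewrite mxE (le_trans (ler_norm_sum _ _ _))//.
apply: (@le_trans _ _ (\sum_(k < m) a * b)).
  by apply: ler_sum => k _; rewrite normrM ler_pM.
by rewrite sumr_const card_ord mulr_natl.
Qed.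

Lemma derivable_continuous1 (a : R -> R) : (forall x, derivable a x 1) -> continuous a.
Proof.
by move=> d x; apply: differentiable_continuous; apply/derivable1_diffP.
Qed.

Lemma smooth_bounded_derive1 (V : normedModType R) (F : R -> V) :
  smooth_bounded F -> smooth_bounded (derive1 F).
Proof.
move=> [dF bF]; split => k.
  by move=> x; have := dF k.+1 x; rewrite /derive1n iterSr.
by have [M hM] := bF k.+1; exists M => x; have := hM x; rewrite /derive1n iterSr.
Qed.

Lemma smooth_bounded_C1 m (B : R -> 'M[R]_m.+1) : smooth_bounded B ->
  C1_bounded_mx B (derive1 B).
Proof.
move=> sB i j; have [dB bB] := sB; split.
- by move=> x; apply: derive1_entry; exact: (dB 0%N).
- apply: derivable_continuous1 => x.
  by have /derivable_mxP := dB 1%N x.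
- have [M0 h0] := bB 0%N; have [M1 h1] := bB 1%N.
  exists (M0 + M1) => x.
  have a0 : 0 <= M0 := le_trans (normr_ge0 _) (h0 x).
  have a1 : 0 <= M1 := le_trans (normr_ge0 _) (h1 x).
  split; apply: (le_trans (entry_le_norm _ _ _)).
    by apply: (le_trans (h0 x)); rewrite lerDl.
  by apply: (le_trans (h1 x)); rewrite lerDr.
Qed.

(** Differentiating A^-1 A = 1 gives (A^-1)' = - A^-1 A' A^-1, which is
bounded and continuous along with A^-1 and A'. *)
Lemma C1_invmx m (A : R -> 'M[R]_m.+1) : smooth_bounded A -> uniformly_invertible A ->
  C1_bounded_mx (fun x => invmx (A x))
    (fun x => - (invmx (A x) *m (derive1 A x *m invmx (A x)))).
Proof.
move=> sA [M hM]; have [dA bA] := sA; have [M1 h1] := bA 1%N.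
have uA x : A x \in unitmx by have [] := hM x.
have dAij x i j : derivable (fun y => A y i j) x 1.
  by have /derivable_mxP := dA 0%N x.
have dA'ij x i j : derivable (fun y => derive1 A y i j) x 1.
  by have /derivable_mxP := dA 1%N x.
have dG x := derivable_invmx uA (dAij x).
have M0 : 0 <= M := le_trans (normr_ge0 _) (hM 0).2.
have bG x i j : `|invmx (A x) i j| <= M := le_trans (entry_le_norm _ _ _) (hM x).2.
have bA' x i j : `|derive1 A x i j| <= M1 := le_trans (entry_le_norm _ _ _) (h1 x).
move=> i j; split.
- move=> x.
  pose G' := \matrix_(i, j) 'D_1 (fun y => (invmx (A y)) i j) x.
  (* G' collects the derivatives of the entries; they exist by the Cramer
     formula, and it remains to identify them. *)
  suff <- : G' = - (invmx (A x) *m (derive1 A x *m invmx (A x))).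
    by rewrite mxE; apply: DeriveDef.
  suff H : G' *m A x = - (invmx (A x) *m derive1 A x).
    by rewrite -[LHS](mulmxK (uA x)) H mulNmx mulmxA.
  apply/matrixP => k l.
  have dkl p : is_derive x 1 ((fun y => invmx (A y) k p) * (fun y => A y p l))
     (invmx (A x) k p * derive1 A x p l + A x p l * G' k p).
    have d1 : is_derive x 1 (fun y => invmx (A y) k p) (G' k p).
      by rewrite mxE; apply: DeriveDef.
    have d2 := derive1_entry p l (dA 0%N x).
    by apply: is_derive_eq.
  have ds := is_derive_sum dkl.
  have E : \sum_(p < m.+1) ((fun y => invmx (A y) k p) * (fun y => A y p l)) =
      cst ((k == l)%:R : R).
    apply/funext => y; rewrite fct_sumE.
    have := congr1 (fun X : 'M[R]_m.+1 => X k l) (mulVmx (uA y)).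
    by rewrite !mxE.
  rewrite E in ds.
  have := ds.(ex_derive). have [_ {}ds] := ds; rewrite derive_cst in ds => _.
  rewrite !mxE; apply/eqP; rewrite -addr_eq0 -big_split/=; apply/eqP.
  by rewrite [RHS]ds; apply: eq_bigr => p _; rewrite addrC [X in _ + X]mulrC !mxE.
- apply: derivable_continuous1 => x; under eq_fun do rewrite mxE.
  apply: derivableN; apply: derivable_mulmx => //.
  by move=> ? ?; apply: derivable_mulmx.
- exists (M + m.+1%:R * (M * (m.+1%:R * (M1 * M)))) => x.
  have M10 : 0 <= M1 := le_trans (normr_ge0 _) (h1 x).
  split.
    by apply: (le_trans (bG x i j)); rewrite lerDl !mulr_ge0.
  rewrite mxE normrN.
  apply: (@le_trans _ _ (m.+1%:R * (M * (m.+1%:R * (M1 * M))))); last by rewrite lerDr.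
  by apply: mul_entry_le => // k l; exact: mul_entry_le.
Qed.

End SmoothMatrices.

(** * Bounds on successive weak derivatives *)

Section SobolevBounds.
Variables (R : realType) (n : nat).
Local Notation mu := (@lebesgue_measure R).
Local Notation vfun := (R -> 'cV[R[i]]_n).
Implicit Types h g : vfun.

(** Squared bound K on h and on its weak derivatives up to order m. The
derivatives are existentially quantified, so that closure properties can be
proved without reference to the representative chosen by [wD]. *)
Fixpoint sobolev_bound (m : nat) (K : R) (h : vfun) : Prop :=
  [/\ inL2 h, (L2sq h <= K%:E)%E &
   if m is m'.+1 then exists2 g, weak_deriv h g & sobolev_bound m' K g else True].

Lemma sobolev_bound0 m K h : sobolev_bound m K h -> inL2 h /\ (L2sq h <= K%:E)%E.
Proof. by case: m => [|m] []. Qed.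

Lemma sobolev_bound_ge0 m K h : sobolev_bound m K h -> 0 <= K.
Proof. by move=> /sobolev_bound0[_ hK]; have := le_trans (L2sq_ge0 h) hK;
  rewrite lee_fin. Qed.

Lemma sobolev_bound_le m K K' h : K <= K' -> sobolev_bound m K h ->
  sobolev_bound m K' h.
Proof.
move=> KK; elim: m h => [|m IH] h /= [hL hK H].
  by split=> //; apply: (le_trans hK); rewrite lee_fin.
split=> //; first by apply: (le_trans hK); rewrite lee_fin.
by case: H => g hg /IH; exists g.
Qed.

Lemma sobolev_boundW m K h : sobolev_bound m.+1 K h -> sobolev_bound m K h.
Proof.
elim: m h => [|m IH] h; first by case=> hL hK _; split.
by case=> hL hK [g hg /IH H]; split => //; exists g.
Qed.

Lemma sobolev_bound_ae m K h h' : {ae mu, forall x, h x = h' x} -> inL2 h' ->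
  sobolev_bound m K h -> sobolev_bound m K h'.
Proof.
case: m => [|m] hh h'L [hL hK H]; split=> //; rewrite -?(L2sq_ae hL h'L hh)//.
case: H => g hg Hg; exists g => //.
have [_ gL _] := hg.
by apply: (weak_deriv_ae hg hh _ h'L gL); exact: aeW.
Qed.

Let mule2_le (a b : \bar R) (K K' : R) : (a <= K%:E)%E -> (b <= K'%:E)%E ->
  (2%:E * (a + b) <= (2 * (K + K'))%:E)%E.
Proof.
move=> aK bK; rewrite EFinM; apply: lee_wpmul2l; first by rewrite lee_fin.
exact: (leeD aK bK).
Qed.

Lemma sobolev_boundD m K K' h g : sobolev_bound m K h -> sobolev_bound m K' g ->
  sobolev_bound m (2 * (K + K')) (fun x => h x + g x).
Proof.
elim: m h g => [|m IH] h g [hL hK H] [gL gK G].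
  split=> //; first exact: inL2_D.
  exact: (le_trans (L2sqD_le hL gL) (mule2_le hK gK)).
split=> //; first exact: inL2_D.
  exact: (le_trans (L2sqD_le hL gL) (mule2_le hK gK)).
case: H => h' hh' Hh'; case: G => g' gg' Hg'.
exists (fun x => h' x + g' x); first exact: weak_deriv_D.
exact: IH.
Qed.

Lemma L2sqZ_le (c : R[i]) h : inL2 h ->
  (L2sq (fun x => c *: h x)%R <= (sqmod c)%:E * L2sq h)%E.
Proof.
move=> hL; apply: L2sq_le => //; [exact: inL2_Z|exact: sqmod_ge0|].
by move=> x; rewrite sqlenZ.
Qed.

Lemma sobolev_boundZ m K (c : R[i]) h : sobolev_bound m K h ->
  sobolev_bound m (sqmod c * K) (fun x => c *: h x).
Proof.
elim: m h => [|m IH] h [hL hK H].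
  split=> //; first exact: inL2_Z.
  apply: (le_trans (L2sqZ_le c hL)).
  by rewrite EFinM lee_wpmul2l ?lee_fin ?sqmod_ge0.
split=> //; first exact: inL2_Z.
  apply: (le_trans (L2sqZ_le c hL)).
  by rewrite EFinM lee_wpmul2l ?lee_fin ?sqmod_ge0.
case: H => h' hh' Hh'; exists (fun x => c *: h' x); first exact: weak_deriv_Z.
exact: IH.
Qed.

Lemma sqmodN1 : sqmod (-1 : R[i]) = 1.
Proof. by rewrite /sqmod /= oppr0 expr0n addr0 sqrrN expr1n. Qed.

Lemma sobolev_boundN m K h : sobolev_bound m K h -> sobolev_bound m K (fun x => - h x).
Proof.
move/(sobolev_boundZ (-1)); rewrite sqmodN1 mul1r.
by under eq_fun do rewrite scaleN1r.
Qed.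

Lemma weak_deriv0 : weak_deriv (fun _ : R => 0 : 'cV[R[i]]_n) (fun _ : R => 0).
Proof.
apply/weak_derivE => i.
have -> : reC (fun _ : R => 0 : 'cV[R[i]]_n) i = (fun _ : R => 0).
  by apply/funext => x; rewrite /reC mxE.
have -> : imC (fun _ : R => 0 : 'cV[R[i]]_n) i = (fun _ : R => 0).
  by apply/funext => x; rewrite /imC mxE.
by split; exact: wderiv0.
Qed.

Lemma sobolev_bound_zero m : sobolev_bound m 0 (fun _ : R => 0 : 'cV[R[i]]_n).
Proof.
have [h0 _ _] := weak_deriv0.
have N0 : (L2sq (fun _ : R => 0%R : 'cV[R[i]]_n) <= 0%:E)%E.
  rewrite /L2sq (_ : sqlen (0 : 'cV[R[i]]_n) = 0) ?integral0//.
  by rewrite /sqlen big1// => i _; rewrite mxE /sqmod/= expr0n addr0.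
elim: m => [|m IH]; split => //.
exists (fun=> 0) => //; exact: weak_deriv0.
Qed.

(** The factor 4 leaves room for the 2 lost in each of the d additions. *)
Lemma sobolev_bound_sum m d (K : R) (F : 'I_d -> vfun) :
  (forall j, sobolev_bound m K (F j)) ->
  0 <= K -> sobolev_bound m (4 ^+ d * K) (fun x => \sum_j F j x).
Proof.
move=> + K0; elim: d F => [|d IH] F HF.
  under eq_fun do rewrite big_ord0.
  by apply: sobolev_bound_le (sobolev_bound_zero m); rewrite mul1r.
under eq_fun do rewrite big_ord_recl.
apply: (@sobolev_bound_le _ (2 * (K + 4 ^+ d * K)));
  last by apply: sobolev_boundD => //; exact: IH.
have : 1 <= 4 ^+ d :> R by rewrite exprn_ege1// ler1n.
rewrite exprS; nra.
Qed.

End SobolevBounds.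

(** * Multiplication by matrices on Sobolev spaces *)

Section Multipliers.
Variables (R : realType) (n : nat).
Local Notation mu := (@lebesgue_measure R).
Local Notation vfun := (R -> 'cV[R[i]]_n.+1).
Implicit Types h g : vfun.

(** The bounded multipliers of the Sobolev space H^m. *)
Definition multiplier (m : nat) (B : R -> 'M[R]_n.+1) : Prop :=
  exists2 C : R, 0 <= C & forall K h, sobolev_bound m K h ->
    sobolev_bound m (C * K) (fun x => cmx (B x) *m h x).

(** The sum of the bounds of all entries is a common bound. *)
Lemma C1_bounded_mx_bound (B B' : R -> 'M[R]_n.+1) : C1_bounded_mx B B' ->
  exists2 M : R, 0 <= M & forall x i j, `|B x i j| <= M.
Proof.
move=> C1.
have H ij : exists M : R, forall x, `|B x ij.1 ij.2| <= M.
  by have [_ _ [M hM]] := C1 ij.1 ij.2; exists M => x; have [] := hM x.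
pose F ij := sval (cid (H ij)).
have F0 ij : 0 <= F ij by exact: le_trans (normr_ge0 _) (svalP (cid (H ij)) 0).
exists (\sum_ij F ij); first by apply: sumr_ge0 => ij _.
move=> x i j; rewrite (bigD1 (i, j))//=.
apply: (le_trans (svalP (cid (H (i, j))) x)); rewrite lerDl.
by apply: sumr_ge0.
Qed.

Lemma multiplier0 (B B' : R -> 'M[R]_n.+1) : C1_bounded_mx B B' -> multiplier 0 B.
Proof.
move=> C1; have [M M0 hM] := C1_bounded_mx_bound C1.
pose C : R := n.+1%:R * n.+1%:R * M ^+ 2.
have C0 : 0 <= C by rewrite !mulr_ge0 ?sqr_ge0.
exists C => // K h [hL hK _].
have BhL := inL2_mul C1 hL.
split => //; apply: (le_trans (L2sq_le BhL hL C0 _)).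
  by move=> x; apply: sqlen_mul_le => i j; exact: hM.
by rewrite (EFinM C K); apply: lee_wpmul2l; rewrite ?lee_fin.
Qed.

(** By the product rule (B h)' = B' h + B h'. *)
Lemma multiplierS m (B B' : R -> 'M[R]_n.+1) : C1_bounded_mx B B' ->
  multiplier m B -> multiplier m B' -> multiplier m.+1 B.
Proof.
move=> C1 [C C0 hC] [C' C'0 hC']; have [D D0 hD] := multiplier0 C1.
exists (D + 2 * (C' + C)); first by rewrite !addr_ge0 ?mulr_ge0 ?addr_ge0.
move=> K h Hh; have K0 := sobolev_bound_ge0 Hh.
have [hL hK [g hg Hg]] := Hh.
have [BhL BhK _] := hD K h (And3 hL hK I).
split => //.
  apply: (le_trans BhK); rewrite lee_fin ler_wpM2r// lerDl.
  by rewrite mulr_ge0 ?addr_ge0.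
exists (fun x => cmx (B' x) *m h x + cmx (B x) *m g x).
  exact: weak_deriv_mul.
apply: (@sobolev_bound_le _ _ _ (2 * (C' * K + C * K))).
  by rewrite -mulrDl mulrA ler_wpM2r// lerDr.
by apply: sobolev_boundD; [apply: hC'; exact: sobolev_boundW Hh|exact: hC].
Qed.

Lemma smooth_multiplier m (B : R -> 'M[R]_n.+1) : smooth_bounded B -> multiplier m B.
Proof.
elim: m B => [|m IH] B sB; first exact: multiplier0 (smooth_bounded_C1 sB).
apply: (multiplierS (smooth_bounded_C1 sB)); first exact: IH.
by apply: IH; exact: smooth_bounded_derive1.
Qed.

Lemma multiplier_mul m (B B' : R -> 'M[R]_n.+1) : multiplier m B -> multiplier m B' ->
  multiplier m (fun x => B x *m B' x).
Proof.
move=> [C C0 hC] [C' C'0 hC']; exists (C * C'); first exact: mulr_ge0.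
move=> K h /hC'/hC; rewrite mulrA.
by under eq_fun do rewrite mulmxA -map_mxM.
Qed.

Lemma multiplierN m (B : R -> 'M[R]_n.+1) : multiplier m B ->
  multiplier m (fun x => - B x).
Proof.
move=> [C C0 hC]; exists C => // K h /hC/sobolev_boundN.
by under eq_fun do rewrite -mulNmx -map_mxN.
Qed.

(** The derivative - A^-1 A' A^-1 of the inverse involves only A' and the
inverse itself, so that the product rule closes an induction on m. *)
Lemma inverse_multiplier m (A : R -> 'M[R]_n.+1) :
  smooth_bounded A -> uniformly_invertible A -> multiplier m (fun x => invmx (A x)).
Proof.
move=> sA uA; have C1 := C1_invmx sA uA.
elim: m => [|m IH]; first exact: multiplier0 C1.
apply: (multiplierS C1) => //; apply: multiplierN; apply: multiplier_mul => //.
apply: multiplier_mul => //.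
by apply: smooth_multiplier; exact: smooth_bounded_derive1.
Qed.

End Multipliers.

(** * Sobolev norms and iterated weak derivatives *)

Section SobolevNorm.
Variables (R : realType) (n : nat).
Local Notation mu := (@lebesgue_measure R).
Local Notation vfun := (R -> 'cV[R[i]]_n).
Implicit Types h g : vfun.

(** By uniqueness the derivative chosen by [wD] agrees almost everywhere with
the one provided by the bound. *)
Lemma sobolev_bound_wD m K h : sobolev_bound m.+1 K h ->
  weak_deriv h (wD h) /\ sobolev_bound m K (wD h).
Proof.
move=> [hL hK [g hg Hg]]; have hw := weak_deriv_wD (ex_intro _ g hg).
split => //; have [_ wL _] := hw.
exact: (sobolev_bound_ae (weak_deriv_uniq hg hw) wL Hg).
Qed.

Lemma sobolev_bound_iter m K h j : sobolev_bound m K h -> (j <= m)%N ->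
  sobolev_bound (m - j) K (iter j (@wD R n) h).
Proof.
move=> Hh; elim: j => [|j IH] jm; first by rewrite subn0.
rewrite iterS; have := IH (ltnW jm); rewrite -(subnSK jm).
by move=> /sobolev_bound_wD[].
Qed.

(** The argument of the square root in [Hs_norm]. *)
Definition Hs_sq (s : R) h : \bar R :=
  let k := Num.truncn s in
  let sigma := s - k%:R in
  (\sum_(j < k.+1) L2sq (iter j (@wD R n) h)
    + (if (sigma == 0)%R then 0 else gagliardo_sq sigma (iter k (@wD R n) h)))%E.

Lemma gagliardo_sq_ge0 (s : R) h : (0 <= gagliardo_sq s h)%E.
Proof.
apply: integral_ge0 => x _; apply: integral_ge0 => y _.
by rewrite lee_fin divr_ge0 ?sqr_ge0 ?powR_ge0.
Qed.

Lemma sqr_poweR12 (x : \bar R) : (0 <= x -> (x `^ 2^-1) ^+ 2 = x)%E.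
Proof. by move=> x0; rewrite poweR12_sqrt// sqr_sqrte. Qed.

Lemma Hs_normE (s : R) h : Hs_norm s h = (Hs_sq s h `^ 2^-1)%E.
Proof.
rewrite /Hs_norm /Hs_sq; congr ((_ + _) `^ _)%E.
by apply: eq_bigr => j _; rewrite L2normE sqr_poweR12 ?L2sq_ge0.
Qed.

Lemma Hs_sq_ge0 s h : (0 <= Hs_sq s h)%E.
Proof.
rewrite /Hs_sq adde_ge0//; first by apply: sume_ge0 => j _; exact: L2sq_ge0.
by case: ifP => // _; exact: gagliardo_sq_ge0.
Qed.

Lemma Hs_sq_lty s h : inHs s h -> (Hs_sq s h < +oo)%E.
Proof. by move=> [_ _]; rewrite Hs_normE => /lty_poweRy; apply. Qed.

Lemma L2sq_le_Hs_sq s h j : (j <= Num.truncn s)%N ->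
  (L2sq (iter j (@wD R n) h) <= Hs_sq s h)%E.
Proof.
move=> js; rewrite /Hs_sq.
have jk : (j < (Num.truncn s).+1)%N by [].
rewrite (bigD1 (Ordinal jk))//= -addeA leeDl// adde_ge0//.
  by apply: sume_ge0 => i _; exact: L2sq_ge0.
by case: ifP => // _; exact: gagliardo_sq_ge0.
Qed.

Lemma inHs_sobolev_bound s h : inHs s h ->
  sobolev_bound (Num.truncn s) (fine (Hs_sq s h)) h.
Proof.
move=> Hh; have fin := Hs_sq_lty Hh; have [hL hD _] := Hh.
have E : (fine (Hs_sq s h))%:E = Hs_sq s h by rewrite fineK// ge0_fin_numE// Hs_sq_ge0.
have wdj j : (j < Num.truncn s)%N ->
    weak_deriv (iter j (@wD R n) h) (iter j.+1 (@wD R n) h).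
  by move=> /hD/weak_deriv_wD.
have jL j : (j <= Num.truncn s)%N -> inL2 (iter j (@wD R n) h).
  by case: j => [//|j] /wdj[].
suff H m : (m <= Num.truncn s)%N ->
    sobolev_bound m (fine (Hs_sq s h)) (iter (Num.truncn s - m) (@wD R n) h).
  by have := H (Num.truncn s) (leqnn _); rewrite subnn.
elim: m => [|m IH] ms.
  rewrite subn0; split=> //; first exact: jL.
  by rewrite E L2sq_le_Hs_sq.
split.
- by apply: jL; exact: leq_subr.
- by rewrite E L2sq_le_Hs_sq// leq_subr.
- exists (iter (Num.truncn s - m) (@wD R n) h); last exact: IH (ltnW ms).
  by rewrite -(subnSK ms); apply: wdj; rewrite subnSK// leq_subr.
Qed.

(** The bound covers the derivatives of order k and k + 1, k the integer part
of s, and by [gagliardo_sq_le] these two control the fractional seminorm. *)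
Lemma sobolev_bound_Hs_sq (s : R) : 0 <= s -> exists2 C : R, 0 <= C &
  forall K h, sobolev_bound (Num.truncn s).+1 K h -> (Hs_sq s h <= (C * K)%:E)%E.
Proof.
move=> s0; set k := Num.truncn s.
have /andP[ks sk] : k%:R <= s < k.+1%:R by exact: truncn_itv.
pose sg := s - k%:R.
pose G : R := 2 * incr_kernel_mass sg.
have G0 : 0 <= G.
  have ? : sg < 1 by rewrite /sg; move: sk; rewrite -natr1; lra.
  have ? : 0 <= sg by rewrite /sg; lra.
  by rewrite mulr_ge0// addr_ge0// ?mulr_ge0// invr_ge0; lra.
exists (k.+1%:R + 2 * G); first by rewrite addr_ge0// mulr_ge0.
move=> K h Hh; have K0 := sobolev_bound_ge0 Hh.
have NK j : (j <= k.+1)%N -> (L2sq (iter j (@wD R n) h) <= K%:E)%E.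
  by move=> jk; have /sobolev_bound0[] := sobolev_bound_iter Hh jk.
rewrite mulrDl EFinD /Hs_sq; apply: leeD.
  apply: (@le_trans _ _ (\sum_(j < k.+1) K%:E)%E).
    by apply: lee_sum => j _; apply: NK; exact: ltnW.
  by rewrite sumEFin sumr_const card_ord mulr_natl.
rewrite -/k -/sg; case: ifP => [_|sg0]; first by rewrite lee_fin;
  do 2 apply: mulr_ge0 => //.
have sg01 : 0 < sg < 1.
  rewrite lt_def sg0 subr_ge0 ks/= /sg; move: sk; rewrite -natr1; lra.
have := sobolev_bound_iter Hh (leqnSn k); rewrite subSnn => /sobolev_bound_wD[wk _].
apply: (le_trans (gagliardo_sq_le sg01 wk)).
rewrite -/G (_ : 2 * G * K = G * (K + K)); last ring.
rewrite (EFinM G (K + K)); apply: lee_wpmul2l; first by rewrite lee_fin.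
by rewrite EFinD; apply: leeD; [exact: (NK k (leqnSn k))|exact: (NK k.+1 (leqnn _))].
Qed.

End SobolevNorm.

(** * A priori estimates for the resolvent equation *)

Section ResolventEstimates.
Variables (R : realType) (d n : nat).
Variables (A : 'I_d.+1 -> R -> 'M[R]_n.+1) (E : R -> 'M[R]_n.+1).
Hypothesis A_smooth : forall j, smooth_bounded (A j).
Hypothesis E_smooth : smooth_bounded E.
Hypothesis A_inv : uniformly_invertible (A ord0).
Local Notation mu := (@lebesgue_measure R).
Local Notation vfun := (R -> 'cV[R[i]]_n.+1).
Implicit Types (v f : vfun) (xi : 'rV[R]_d).

(** The part of - L_xi that does not differentiate v. *)
Definition zeroth xi v : vfun := fun x =>
  \sum_(j < d) ('i%C * (xi ord0 j)%:C%C) *: (cmx (A (lift ord0 j) x) *m v x)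
  + cmx (E x) *m v x.

Lemma freq_norm_ge0 xi : 0 <= freq_norm xi.
Proof. exact: sqrtr_ge0. Qed.

Lemma freq_norm_sqr xi : freq_norm xi ^+ 2 = \sum_(j < d) xi ord0 j ^+ 2.
Proof. by rewrite sqr_sqrtr// sumr_ge0// => j _; exact: sqr_ge0. Qed.

(** The quadratic growth in xi is that of a first-order symbol, for squared
norms. *)
Lemma zeroth_bound m : exists2 C : R, 0 <= C & forall xi K v, sobolev_bound m K v ->
  sobolev_bound m (C * (1 + freq_norm xi ^+ 2) * K) (zeroth xi v).
Proof.
have [CE CE0 hE] := smooth_multiplier m E_smooth.
have /all_sig2[CA CA0 hA] : forall j : 'I_d, {C :
  R | 0 <= C & forall K h, sobolev_bound m K h ->
    sobolev_bound m (C * K) (fun x => cmx (A (lift ord0 j) x) *m h x)}.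
  by move=> j; apply: cid2; exact: smooth_multiplier.
pose S := \sum_j CA j.
have S0 : 0 <= S by apply: sumr_ge0.
exists (2 * (4 ^+ d * S + CE));
  first by rewrite mulr_ge0// addr_ge0// mulr_ge0// exprn_ge0.
move=> xi K v Hv; have K0 := sobolev_bound_ge0 Hv.
set q := 1 + _; have q1 : 1 <= q by rewrite lerDl sqr_ge0.
have q0 : 0 <= q by lra.
have xiq j : sqmod ('i%C * (xi ord0 j)%:C%C) <= q.
  have -> : sqmod ('i%C * (xi ord0 j)%:C%C) = xi ord0 j ^+ 2 by rewrite /sqmod/=; ring.
  rewrite /q freq_norm_sqr (bigD1 j)//= addrCA lerDl addr_ge0// sumr_ge0// => i _.
  exact: sqr_ge0.
apply: (@sobolev_bound_le _ _ _ (2 * (4 ^+ d * (q * S * K) + CE * K))).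
  have : CE * K <= CE * q * K by rewrite ler_wpM2r// ler_peMr.
  nra.
apply: sobolev_boundD; last exact: hE.
apply: sobolev_bound_sum; last by rewrite !mulr_ge0.
move=> j; apply: sobolev_bound_le (sobolev_boundZ _ (hA j K v Hv)).
rewrite mulrA; apply: ler_wpM2r => //; apply: ler_pM => //; first exact: sqmod_ge0.
by rewrite /S (bigD1 j)//= lerDl sumr_ge0.
Qed.

Lemma resolvent_eqE xi lam v f : resolvent_eq A E xi lam v f ->
  {ae mu, forall x, f x + (- (cmx (A ord0 x) *m wD v x) + - zeroth xi v x) = lam *: v x}.
Proof.
apply: filterS; first exact: (ae_filter_ringOfSetsType mu).
move=> x <-; rewrite /Lop /zeroth.
set a := _ *m wD v x; set b := \sum_(j < d) _; set c := cmx (E x) *m v x.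
by rewrite (_ : - a - b - c = - a + - (b + c)) ?subrK// opprD addrA.
Qed.

Lemma L2sqZ_ge (c : R[i]) v : inL2 v ->
  ((sqmod c)%:E * L2sq v <= L2sq (fun x => c *: v x)%R)%E.
Proof.
move=> vL; rewrite /L2sq -ge0_integralZl//.
- apply: ge0_le_integral => //.
  + by move=> x _; rewrite -EFinM lee_fin mulr_ge0 ?sqmod_ge0 ?sqlen_ge0.
  + by apply: measurable_funeM; exact: measurable_sqlen.
  + by apply: measurable_sqlen; exact: inL2_Z.
  + by move=> x _; rewrite sqlenZ.
- exact: measurable_sqlen.
- by move=> x _; rewrite lee_fin sqlen_ge0.
- by rewrite lee_fin sqmod_ge0.
Qed.

(** The equation expresses lambda v through f, v' and the terms of order zero,
and |tau| <= |lambda|. *)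
Lemma temporal_bound : exists2 C : R, 0 <= C &
  forall xi gamma tau v f F V' V, resolvent_eq A E xi (gamma +i* tau)%C v f ->
  sobolev_bound 0 F f -> sobolev_bound 0 V' (wD v) -> sobolev_bound 0 V v ->
  ((tau ^+ 2)%:E * L2sq v <= (C * (F + V' + (1 + freq_norm xi ^+ 2) * V))%:E)%E.
Proof.
have [C0 C00 h0] := smooth_multiplier 0 (A_smooth ord0).
have [C1 C10 h1] := zeroth_bound 0.
exists (2 + 4 * C0 + 4 * C1); first by rewrite !addr_ge0// mulr_ge0.
move=> xi gamma tau v f F V' V req fF vV' vV.
have F0 := sobolev_bound_ge0 fF; have V'0 := sobolev_bound_ge0 vV'; have V0 :=
  sobolev_bound_ge0 vV.
have [vL _] := sobolev_bound0 vV.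
have H := sobolev_boundD fF (sobolev_boundD (sobolev_boundN (h0 _ _ vV')) (sobolev_boundN (h1 xi _ _ vV))).
have [_ ] := sobolev_bound0 (sobolev_bound_ae (resolvent_eqE req) (inL2_Z _ vL) H).
move/(le_trans (L2sqZ_ge (gamma +i* tau)%C vL)) => {}H.
apply: (@le_trans _ _ ((sqmod (gamma +i* tau)%C)%:E * L2sq v)%E).
  apply: lee_wpmul2r; first exact: L2sq_ge0.
  by rewrite lee_fin /sqmod/= lerDr sqr_ge0.
apply: (le_trans H); rewrite lee_fin.
have : 0 <= (1 + freq_norm xi ^+ 2) * V by rewrite mulr_ge0// addr_ge0 ?sqr_ge0.
rewrite -[C1 * _ * V]mulrA.
move: (_ * V) => q q0.
have := mulr_ge0 C00 F0; have := mulr_ge0 C00 q0; have := mulr_ge0 C10 F0.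
have := mulr_ge0 C10 V'0; nra.
Qed.

(** Solve the equation for v', as A_1 is invertible; multiplication by A_1^-1
and by the coefficients is bounded at order m. *)
Lemma derivative_bound m (gamma N : R) : exists2 C : R, 0 <= C &
  forall xi tau v f K, freq_norm xi <= N -> `|tau| <= N ->
  resolvent_eq A E xi (gamma +i* tau)%C v f -> weak_deriv v (wD v) ->
  sobolev_bound m K f -> sobolev_bound m K v -> sobolev_bound m (C * K) (wD v).
Proof.
have [CI CI0 hI] := inverse_multiplier m (A_smooth ord0) A_inv.
have [C1 C10 h1] := zeroth_bound m.
(* L bounds |lambda|^2. *)
pose L := gamma ^+ 2 + N ^+ 2.
have L0 : 0 <= L by rewrite addr_ge0 ?sqr_ge0.
have q0 : 0 <= 1 + N ^+ 2 by rewrite addr_ge0 ?sqr_ge0.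
exists (CI * (2 * (1 + 2 * (L + C1 * (1 + N ^+ 2))))).
  by rewrite mulr_ge0// mulr_ge0// addr_ge0// mulr_ge0// addr_ge0// mulr_ge0.
move=> xi tau v f K xiN tauN req wv fK vK; have K0 := sobolev_bound_ge0 fK.
have N0 : 0 <= N := le_trans (normr_ge0 _) tauN.
have [_ wL _] := wv.
have Hl : sobolev_bound m (L * K) (fun x => - ((gamma +i* tau)%C *: v x)).
  apply: sobolev_boundN; apply: sobolev_bound_le (sobolev_boundZ _ vK);
    rewrite ler_wpM2r//.
  by rewrite /sqmod/= /L lerD2l -real_normK ?num_real// lerXn2r ?nnegrE.
have Hz : sobolev_bound m (C1 * (1 + N ^+ 2) * K) (fun x => - zeroth xi v x).
  apply: sobolev_boundN; apply: sobolev_bound_le (h1 xi _ _ vK);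
    rewrite ler_wpM2r// ler_wpM2l//.
  by rewrite lerD2l lerXn2r ?nnegrE// freq_norm_ge0.
have := hI _ _ (sobolev_boundD fK (sobolev_boundD Hl Hz)).
rewrite (_ : CI * _ * K = CI * (2 * (K + 2 * (L * K + C1 * (1 + N ^+ 2) * K))));
  last ring.
apply: sobolev_bound_ae => //; have := resolvent_eqE req.
apply: filterS; first exact: (ae_filter_ringOfSetsType mu).
move=> x <-; rewrite addrA.
have -> : forall a b c : 'cV[R[i]]_n.+1, a - (a + (- b + - c)) - c = b.
  by move=> a b c; rewrite !opprD !opprK addrA subrr add0r addrK.
by rewrite mulmxA -map_mxM mulVmx ?map_mx1 ?mul1mx//; have [M /(_ x)[]] := A_inv.
Qed.

(** Bootstrap: starting from the L^2 norm of v, [derivative_bound] gains one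
order at each step, as long as f has that many derivatives. *)
Lemma regularity m (gamma N : R) : exists2 C : R, 0 <= C &
  forall xi tau v f K, freq_norm xi <= N -> `|tau| <= N ->
  resolvent_eq A E xi (gamma +i* tau)%C v f -> weak_deriv v (wD v) ->
  sobolev_bound m K f -> sobolev_bound 0 K v -> sobolev_bound m.+1 (C * K) v.
Proof.
elim: m => [|m [C C0 IH]].
  have [C C0 hC] := derivative_bound 0 gamma N.
  exists (1 + C); first exact: addr_ge0.
  move=> xi tau v f K xiN tauN req wv fK vK; have K0 := sobolev_bound_ge0 fK.
  have [vL vN] := sobolev_bound0 vK.
  split => //; first by apply: (le_trans vN); rewrite lee_fin ler_peMl// lerDl.
  exists (wD v) => //; apply: sobolev_bound_le (hC _ _ _ _ _ xiN tauN req wv fK vK).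
  by rewrite ler_wpM2r// lerDr.
have [C' C'0 hC'] := derivative_bound m.+1 gamma N.
exists ((1 + C') * (1 + C)); first by rewrite mulr_ge0// addr_ge0.
move=> xi tau v f K xiN tauN req wv fK vK; have K0 := sobolev_bound_ge0 fK.
have CK : K <= (1 + C) * K by rewrite ler_peMl// lerDl.
have Hv : sobolev_bound m.+1 ((1 + C) * K) v.
  apply: sobolev_bound_le (IH _ _ _ _ _ xiN tauN req wv (sobolev_boundW fK) vK).
  by rewrite ler_wpM2r// lerDr.
have Hw := hC' _ _ _ _ _ xiN tauN req wv (sobolev_bound_le CK fK) Hv.
have [vL vN] := sobolev_bound0 vK.
split => //.
  apply: (le_trans vN); rewrite lee_fin ler_peMl//.
  by have := mulr_ge0 C0 C'0; nra.
exists (wD v) => //; apply: sobolev_bound_le Hw.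
by rewrite mulrA ler_wpM2r// ler_wpM2r ?addr_ge0// lerDr.
Qed.

End ResolventEstimates.

(** * Real-valued norms and frequencies *)

Section RealNorms.
Variables (R : realType) (n : nat).
Local Notation vfun := (R -> 'cV[R[i]]_n).
Implicit Types h : vfun.

(** On [inHs] the extended-real norms are finite; [rL2], [rHs] and [rhat] are
their real values. *)
Definition rL2 h : R := Num.sqrt (fine (L2sq h)).
Definition rHs (s : R) h : R := Num.sqrt (fine (Hs_sq s h)).

Lemma poweR12_fine (x : \bar R) : (0 <= x -> x < +oo ->
  x `^ 2^-1 = (Num.sqrt (fine x))%:E)%E.
Proof. by move=> x0 xoo; rewrite poweR12_sqrt//; case: x x0 xoo. Qed.

Lemma L2sq_lty s h : inHs s h -> (L2sq h < +oo)%E.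
Proof. by move=> hH; apply: le_lt_trans (Hs_sq_lty hH);
  exact: (@L2sq_le_Hs_sq _ _ s h 0). Qed.

Lemma rL2E s h : inHs s h -> L2norm h = (rL2 h)%:E.
Proof. by move=> hH; rewrite L2normE poweR12_fine ?L2sq_ge0 ?(L2sq_lty hH). Qed.

Lemma rHsE s h : inHs s h -> Hs_norm s h = (rHs s h)%:E.
Proof. by move=> hH; rewrite Hs_normE poweR12_fine ?Hs_sq_ge0 ?Hs_sq_lty. Qed.

Lemma rL2_sqr s h : inHs s h -> ((rL2 h) ^+ 2)%:E = L2sq h.
Proof.
move=> hH; rewrite sqr_sqrtr ?fine_ge0 ?L2sq_ge0// fineK// ge0_fin_numE ?L2sq_ge0//.
exact: L2sq_lty hH.
Qed.

Lemma rHs_sqr s h : inHs s h -> ((rHs s h) ^+ 2)%:E = Hs_sq s h.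
Proof.
move=> hH; rewrite sqr_sqrtr ?fine_ge0 ?Hs_sq_ge0// fineK// ge0_fin_numE ?Hs_sq_ge0//.
exact: Hs_sq_lty hH.
Qed.

Lemma inHs_sobolev_bound0 s h j : inHs s h -> (j <= Num.truncn s)%N ->
  sobolev_bound 0 ((rHs s h) ^+ 2) (iter j (@wD R n) h).
Proof.
move=> hH js; have := sobolev_bound_iter (inHs_sobolev_bound hH) js;
  move/sobolev_bound0 => [hL _].
by split => //; rewrite rHs_sqr// L2sq_le_Hs_sq.
Qed.

Definition rhat d (s : R) (xi : 'rV[R]_d) h : R :=
  rHs s h + (1 + freq_norm xi) `^ s * rL2 h.

Lemma rhatE d s (xi : 'rV[R]_d) h : inHs s h -> hatHs_norm s xi h = (rhat s xi h)%:E.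
Proof. by move=> hH; rewrite /hatHs_norm (rHsE hH) (rL2E hH). Qed.

End RealNorms.

Section FrequencyNorms.
Variables (R : realType) (d : nat).
Implicit Types (xi : 'rV[R]_d).

Lemma freq_norm2_sqr xi tau : freq_norm2 xi tau ^+ 2 = freq_norm xi ^+ 2 + tau ^+ 2.
Proof.
rewrite freq_norm_sqr sqr_sqrtr// addr_ge0 ?sqr_ge0// sumr_ge0// => j _.
exact: sqr_ge0.
Qed.

Lemma freq_norm2_le xi tau : freq_norm2 xi tau <= freq_norm xi + `|tau|.
Proof.
have f0 := freq_norm_ge0 xi; have t0 := normr_ge0 tau.
rewrite -(@ler_pXn2r _ 2)// ?nnegrE ?addr_ge0 ?sqrtr_ge0//.
rewrite freq_norm2_sqr -(real_normK (num_real tau)); nra.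
Qed.

Lemma freq_norm_le2 xi tau : freq_norm xi <= freq_norm2 xi tau.
Proof.
rewrite -(@ler_pXn2r _ 2)// ?nnegrE ?freq_norm_ge0 ?sqrtr_ge0//.
by rewrite freq_norm2_sqr lerDl sqr_ge0.
Qed.

Lemma tau_le2 xi tau : `|tau| <= freq_norm2 xi tau.
Proof.
rewrite -(@ler_pXn2r _ 2)// ?nnegrE ?sqrtr_ge0//.
by rewrite freq_norm2_sqr real_normK ?num_real// lerDr sqr_ge0.
Qed.

End FrequencyNorms.

Lemma le_of_sqr (R : realType) (a b : R) : 0 <= b -> a ^+ 2 <= b ^+ 2 -> a <= b.
Proof.
move=> b0; have [a0|a0] := leP 0 a; first by rewrite ler_pXn2r ?nnegrE.
by move=> _; apply: le_trans b0; exact: ltW.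
Qed.

Lemma ler_sqr_ge0 (R : realType) (a b : R) : 0 <= a -> a <= b -> a ^+ 2 <= b ^+ 2.
Proof. by move=> a0 ab; rewrite lerXn2r ?nnegrE// (le_trans a0). Qed.

Lemma sqr1D_ge (R : realType) (x : R) : 0 <= x -> 1 + x ^+ 2 <= (1 + x) ^+ 2.
Proof. nra. Qed.

Lemma sqrD_ge3 (R : realType) (X Y : R) : 0 <= X -> 0 <= Y ->
  Y ^+ 2 + X ^+ 2 + X ^+ 2 <= 2 * (X + Y) ^+ 2.
Proof. by move=> X0 Y0; have := mulr_ge0 X0 Y0; nra. Qed.

(** Half of X is absorbed on the left. *)
Lemma absorb_small (R : realType) (D l X Y : R) :
  X <= D * (Y + l) -> 2 * D * l <= X + Y -> X <= (2 * D + 1) * Y.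
Proof. nra. Qed.

(** * Damping and high-frequency stability *)

Section Equivalence.
Variables (R : realType) (d n : nat).
Variables (A : 'I_d.+1 -> R -> 'M[R]_n.+1) (E : R -> 'M[R]_n.+1).
Hypothesis A_smooth : forall j, smooth_bounded (A j).
Hypothesis E_smooth : smooth_bounded E.
Hypothesis A_inv : uniformly_invertible (A ord0).
Variables (gammas gamma s : R).
Hypothesis gap : gammas < gamma.
Hypothesis s_ge1 : 1 <= s.
Local Notation vfun := (R -> 'cV[R[i]]_n.+1).
Implicit Types (v f : vfun) (xi : 'rV[R]_d).

Let s_ge0 : 0 <= s. Proof. exact: le_trans ler01 s_ge1. Qed.

Let truncn_s : (0 < Num.truncn s)%N.
Proof. by rewrite truncn_gt0. Qed.

Lemma rL2_le_rhat xi v : inHs s v -> (1 + freq_norm xi) * rL2 v <= rhat s xi v.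
Proof.
move=> vH; have x0 := freq_norm_ge0 xi.
apply: (@le_trans _ _ ((1 + freq_norm xi) `^ s * rL2 v));
  last by rewrite lerDr sqrtr_ge0.
by rewrite ler_wpM2r ?sqrtr_ge0// le1r_powR// lerDl.
Qed.

Lemma rHs_le_rhat xi v : rHs s v <= rhat s xi v.
Proof. by rewrite lerDl mulr_ge0 ?powR_ge0 ?sqrtr_ge0. Qed.

Lemma weak_deriv_inHs v : inHs s v -> weak_deriv v (wD v).
Proof. by move=> [_ /(_ 0%N truncn_s) vw _]; exact: weak_deriv_wD. Qed.

(** As |(xi, tau)| <= |xi| + |tau| the two frequencies are treated apart: the
hat norm of v carries the weight (1 + |xi|)^s on its L^2 norm, and
[temporal_bound] handles tau. *)
Lemma high_frequency_absorption : exists2 C : R, 0 <= C &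
  forall xi tau v f, inHs s v -> inHs s f ->
    resolvent_eq A E xi (gamma +i* tau)%C v f ->
  freq_norm2 xi tau * rL2 v <= C * (rhat s xi v + rhat s xi f).
Proof.
have [C C0 hC] := temporal_bound A_smooth E_smooth.
(* The square of |tau| l is at most C (Y^2 + 2 X^2) <= 2 C (X + Y)^2. *)
pose c := Num.sqrt (2 * C).
have c0 : 0 <= c := sqrtr_ge0 _.
exists (1 + c); first exact: addr_ge0.
move=> xi tau v f vH fH req.
set X := rhat s xi v; set Y := rhat s xi f; set l := rL2 v.
have l0 : 0 <= l := sqrtr_ge0 _.
have lX : (1 + freq_norm xi) * l <= X := rL2_le_rhat xi vH.
have x0 := freq_norm_ge0 xi.
have HvX : rHs s v <= X := rHs_le_rhat xi v.
have HfY : rHs s f <= Y := rHs_le_rhat xi f.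
have Hv0 : 0 <= rHs s v := sqrtr_ge0 _.
have Hf0 : 0 <= rHs s f := sqrtr_ge0 _.
have X0 : 0 <= X := le_trans Hv0 HvX.
have Y0 : 0 <= Y := le_trans Hf0 HfY.
have [vL _ _] := inHs_sobolev_bound0 vH (leq0n _).
have vl : sobolev_bound 0 (l ^+ 2) v by split => //; rewrite (rL2_sqr vH).
have := hC _ _ _ _ _ _ _ _ req (inHs_sobolev_bound0 fH (leq0n _)) (inHs_sobolev_bound0 vH truncn_s) vl.
rewrite -(rL2_sqr vH) -EFinM lee_fin -/l => H.
have tl : `|tau| * l <= c * (X + Y).
  have XY0 : 0 <= X + Y := addr_ge0 X0 Y0.
  apply: le_of_sqr; first exact: mulr_ge0.
  have c2 : c ^+ 2 = 2 * C by apply: sqr_sqrtr; exact: mulr_ge0.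
  rewrite !exprMn real_normK ?num_real// c2.
  apply: (le_trans H); rewrite [2 * C]mulrC -mulrA ler_wpM2l//.
  clearbody X Y l c.
  have h1 : rHs s f ^+ 2 <= Y ^+ 2 := ler_sqr_ge0 Hf0 HfY.
  have h2 : rHs s v ^+ 2 <= X ^+ 2 := ler_sqr_ge0 Hv0 HvX.
  have h3 : (1 + freq_norm xi ^+ 2) * l ^+ 2 <= X ^+ 2.
    apply: (@le_trans _ _ (((1 + freq_norm xi) * l) ^+ 2)); last first.
      by apply: ler_sqr_ge0 lX; apply: mulr_ge0 => //; exact: addr_ge0.
    rewrite exprMn; apply: ler_wpM2r; first exact: sqr_ge0.
    exact: sqr1D_ge.
  apply: (le_trans (lerD (lerD h1 h2) h3)).
  exact: sqrD_ge3.
clearbody X Y l c.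
apply: (@le_trans _ _ ((freq_norm xi + `|tau|) * l)).
  by apply: ler_wpM2r l0 _ _ _; exact: freq_norm2_le.
rewrite !mulrDl mul1r; apply: lerD tl; apply: (@le_trans _ _ X); last by rewrite lerDl.
by apply: le_trans lX; rewrite ler_wpM2r// lerDr.
Qed.

(** The regularity estimate at the order of the integer part of s, with K the
square of the sum of the norms of f and v, so that its square root is linear
in these norms. *)
Lemma bounded_frequency_estimate (N : R) : exists2 C : R, 0 <= C &
  forall xi tau v f, freq_norm2 xi tau <= N ->
  inHs s v -> inHs s f -> resolvent_eq A E xi (gamma +i* tau)%C v f ->
  rhat s xi v <= C * (rhat s xi f + rL2 v).
Proof.
have [C C0 hC] := regularity A_smooth E_smooth A_inv (Num.truncn s) gamma N.
have [C' C'0 hC'] := @sobolev_bound_Hs_sq R n.+1 s s_ge0.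
pose c := Num.sqrt (C' * C).
have c0 : 0 <= c := sqrtr_ge0 _.
exists (c + (1 + N) `^ s); first by rewrite addr_ge0// powR_ge0.
move=> xi tau v f xtN vH fH req.
have xiN := le_trans (freq_norm_le2 xi tau) xtN.
have tauN := le_trans (tau_le2 xi tau) xtN.
have l0 : 0 <= rL2 v := sqrtr_ge0 _.
have Hf0 : 0 <= rHs s f := sqrtr_ge0 _.
have x0 := freq_norm_ge0 xi.
pose K := (rHs s f + rL2 v) ^+ 2.
have fK : sobolev_bound (Num.truncn s) K f.
  apply: sobolev_bound_le (inHs_sobolev_bound fH).
  rewrite -lee_fin fineK -?(rHs_sqr fH)// lee_fin.
  by apply: ler_sqr_ge0 => //; rewrite lerDl.
have vK : sobolev_bound 0 K v.
  have [vL _ _] := inHs_sobolev_bound0 vH (leq0n _); split => //.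
  by rewrite -(rL2_sqr vH) lee_fin; apply: ler_sqr_ge0 => //; rewrite lerDr.
have := hC' _ _ (hC _ _ _ _ _ xiN tauN req (weak_deriv_inHs vH) fK vK).
rewrite -(rHs_sqr vH) lee_fin mulrA => H.
have {}H : rHs s v <= c * (rHs s f + rL2 v).
  apply: le_of_sqr; first by apply: mulr_ge0 => //; exact: addr_ge0.
  have c2 : c ^+ 2 = C' * C by apply: sqr_sqrtr; exact: mulr_ge0.
  by rewrite exprMn c2.
have fY := rHs_le_rhat xi f.
have px : (1 + freq_norm xi) `^ s <= (1 + N) `^ s.
  have N0 : 0 <= N := le_trans x0 xiN.
  by apply: ge0_ler_powR => //; rewrite ?nnegrE ?addr_ge0// lerD2l.
have h2 : (1 + freq_norm xi) `^ s * rL2 v <= (1 + N) `^ s * (rhat s xi f + rL2 v).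
  by apply: ler_pM; rewrite ?powR_ge0// lerDr (le_trans Hf0).
rewrite {1}/rhat mulrDl lerD//; apply: (le_trans H).
by rewrite ler_wpM2l// lerD2r.
Qed.

(** The constants are divided by gamma - gammas, hence the witnesses are
multiplied by it. *)
Lemma damping_iff_stability :
  pseudodifferential_damping A E gammas gamma s <->
  high_frequency_stability A E gammas gamma s.
Proof.
have g0 : 0 < gamma - gammas by rewrite subr_gt0.
have divK (D : R) : D * (gamma - gammas) / (gamma - gammas) = D.
  by rewrite mulfK// gt_eqF.
split=> [[C C0 hC]|[C C0 [N hC]]].
- pose D := C / (gamma - gammas).
  have D0 : 0 < D by rewrite divr_gt0.
  have [c c0 hc] := high_frequency_absorption.
  exists ((2 * D + 1) * (gamma - gammas));
    first by rewrite mulr_gt0// addr_gt0// mulr_gt0.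
  (* Beyond this frequency 2 D l <= X + Y. *)
  exists (2 * D * (c + 1)) => xi tau xt v f vH fH req; rewrite divK.
  have := hC xi tau v f vH fH req; have := hc xi tau v f vH fH req.
  rewrite !(rhatE _ vH) !(rhatE _ fH) (rL2E vH) -EFinD -!EFinM !lee_fin -/D.
  have X0 : 0 <= rhat s xi v := le_trans (sqrtr_ge0 _) (rHs_le_rhat xi v).
  have Y0 : 0 <= rhat s xi f := le_trans (sqrtr_ge0 _) (rHs_le_rhat xi f).
  have l0 : 0 <= rL2 v := sqrtr_ge0 _.
  move: (rhat s xi v) (rhat s xi f) (rL2 v) X0 Y0 l0 => X Y l X0 Y0 l0 H1 H2.
  have H3 : 2 * D * l <= X + Y.
    rewrite -(@ler_pM2l _ (c + 1)) ?ltr_wpDl//.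
    apply: (@le_trans _ _ (freq_norm2 xi tau * l)); last first.
      by apply: (le_trans H1); apply: ler_wpM2r; [exact: addr_ge0|rewrite lerDl].
    by rewrite mulrA ler_wpM2r// mulrC.
  exact: absorb_small H2 H3.
- pose D := C / (gamma - gammas).
  have D0 : 0 < D by rewrite divr_gt0.
  have [c c0 hc] := bounded_frequency_estimate N.
  exists ((D + c) * (gamma - gammas)); first by rewrite mulr_gt0// ltr_wpDr.
  move=> xi tau v f vH fH req; rewrite divK.
  rewrite (rhatE _ vH) (rhatE _ fH) (rL2E vH) -EFinD -EFinM lee_fin.
  have Y0 : 0 <= rhat s xi f := le_trans (sqrtr_ge0 _) (rHs_le_rhat xi f).
  have l0 : 0 <= rL2 v := sqrtr_ge0 _.
  have S0 : 0 <= rhat s xi f + rL2 v by exact: addr_ge0.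
  have [hi|lo] := leP N (freq_norm2 xi tau).
    have := hC xi tau hi v f vH fH req.
    rewrite (rhatE _ vH) (rhatE _ fH) -EFinM lee_fin -/D => /le_trans; apply.
    by apply: ler_pM; rewrite ?lerDl// ltW.
  apply: (le_trans (hc xi tau v f (ltW lo) vH fH req)).
  by rewrite ler_wpM2r// lerDr ltW.
Qed.

End Equivalence.

Theorem proposition2p1 (R : realType) (d n : nat)
  (f : 'I_d.+1 -> 'cV[R]_n.+1 -> 'cV[R]_n.+1)
  (r : 'cV[R]_n.+1 -> 'cV[R]_n.+1)
  (wbar : R -> 'cV[R]_n.+1)
  (f_smooth : forall j : 'I_d.+1, smooth_map (f j))
  (r_smooth : smooth_map r)
  (wbar_smooth : smooth_bounded wbar)
  (wbar_wave : steady_planar_wave f r wbar)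
  (A_smooth : forall j : 'I_d.+1, smooth_bounded (Acoef f wbar j))
  (E_smooth : smooth_bounded (Ecoef f r wbar))
  (A1_inv : uniformly_invertible (Acoef f wbar ord0))
  (gammas gamma s : R)
  (gammas_lt0 : gammas < 0)
  (gamma_gt : gammas < gamma)
  (s_ge1 : 1 <= s) :
  pseudodifferential_damping (Acoef f wbar) (Ecoef f r wbar) gammas gamma s <->
  high_frequency_stability (Acoef f wbar) (Ecoef f r wbar) gammas gamma s.
Proof. exact: damping_iff_stability. Qed.
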